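(* Let $\sigma=(\sigma_t,t\ge0)$ be a (possibly killed) subordinator with Laplace exponent $\phi$. For $\beta\in[0,1]$, the following are equivalent: (i) $\sigma$ satisfies Sinaĭ's condition at $0+$ (resp. at $+\infty$) with index $\beta$; (ii) $\phi$ is regularly varying at $+\infty$ (resp. at $0+$) with index $\beta$.
   Context: A subordinator is a Lévy process with non-decreasing paths; it may be killed, with lifetime $\zeta$, and then $\sigma_t=\infty$ for $t\ge\zeta$. Its Laplace exponent is $$\phi(\lambda)=-\log\mathbf E(e^{-\lambda\sigma_1},1<\zeta)=\kappa+\lambda d+\int_{]0,\infty[}(1-e^{-\lambda y})\nu(dy),\quad\lambda\ge0,$$ where $\kappa,d\ge0$ are the killing rate and drift coefficient and $\nu$, the Lévy measure, is a measure on $]0,\infty[$ with $\int_{]0,\infty[}\min\{1,y\}\nu(dy)<\infty$. Sinaĭ's condition at $+\infty$ (resp. at $0+$) with index $\beta\in[0,1]$: for all $\lambda>1$, $\int_0^\infty\frac{dt}{t}\mathbf P(z<\sigma_t\le\lambda z)\to\beta\log\lambda$ as $z\to+\infty$ (resp. $z\to0+$). A measurable $f:[0,\infty[\to[0,\infty[$ varies regularly at $\infty$ (resp. $0$) with index $\alpha\in\mathbb R$ if, for every $\lambda>0$, $f(\lambda x)/f(x)\to\lambda^\alpha$ as $x\to\infty$ (resp. $x\to0+$).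
   Formalization: The subordinator that is almost surely identically zero is excluded: for it the Laplace exponent vanishes identically, so its regular variation is undefined (0/0), while Sinaĭ's condition holds with index 0. *)

(* Defs.v *)
From HB Require Import structures.
From mathcomp Require Import all_boot all_order all_algebra.
From mathcomp Require Import all_classical all_reals all_analysis.
From mathcomp Require Import measurable_realfun.

Set Implicit Arguments.
Unset Strict Implicit.
Unset Printing Implicit Defensive.

Import Order.TTheory GRing.Theory Num.Theory.
Import numFieldNormedType.Exports.

Local Open Scope classical_set_scope.
Local Open Scope ring_scope.

(** MathComp-Analysis.  A process [(sigma_t, t >= 0)] with values in
    [[0, +oo]] is a function [sigma : R -> Omega -> \bar R] whose values at
    negative times are irrelevant. *)

Definition lifetime (R : realType) (Omega : Type)
    (sigma : R -> Omega -> \bar R) (w : Omega) : \bar R :=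
  ereal_inf [set t%:E | t in [set t : R | 0 <= t /\ sigma t w = +oo%E]].

(** [F_t = sigma(sigma_s, 0 <= s <= t)] *)
Definition natural_filtration (R : realType) (Omega : Type)
    (sigma : R -> Omega -> \bar R) (t : R) : set_system Omega :=
  <<s [set A | exists (s : R) (B : set (\bar R)),
         [/\ 0 <= s <= t, measurable B & A = sigma s @^-1` B] ] >>.

(** Killing is the absorption at [+oo].  [sub_increments] says that,
    conditionally on [t < lifetime], the increment [sigma_(t+s) - sigma_t] is
    independent of [F_t] and is distributed as [sigma_s]; it is multiplied
    through by [P (t < lifetime)].  On that event [sigma_t] is finite, so the
    difference in [\bar R] is the genuine one, equal to [+oo] when killing
    occurs in [(t, t + s]]. *)
Record subordinator (R : realType) (d : measure_display)
    (Omega : measurableType d) (P : probability Omega R)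
    (sigma : R -> Omega -> \bar R) : Prop := Subordinator {
  sub_measurable : forall t : R, 0 <= t -> measurable_fun setT (sigma t) ;
  sub_start : forall w, sigma 0 w = 0%E ;
  sub_nondecreasing : forall w (s t : R), 0 <= s -> s <= t ->
    (sigma s w <= sigma t w)%E ;
  sub_right_continuous : forall w (t : R), 0 <= t ->
    sigma u w @[u --> t^'+] --> sigma t w ;
  sub_increments : forall (s t : R) (A : set Omega) (B : set (\bar R)),
    0 <= s -> 0 <= t -> natural_filtration sigma t A -> measurable B ->
    P (A `&` [set w | (t%:E < lifetime sigma w)%E]
         `&` [set w | B (sigma (t + s)%R w - sigma t w)%E])
    = (P (A `&` [set w | (t%:E < lifetime sigma w)%E])
       * P (sigma s @^-1` B))%E
}.

(** [phi(lambda) = - log E(exp(- lambda sigma_1), 1 < lifetime)] *)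
Definition laplace_exponent (R : realType) (d : measure_display)
    (Omega : measurableType d) (P : probability Omega R)
    (sigma : R -> Omega -> \bar R) (lambda : R) : R :=
  - ln (\int[P]_(w in [set w | (1%:E < lifetime sigma w)%E])
          expR (- (lambda * fine (sigma 1 w)))).

(** [F] is the filter along which [z] varies: [0^'+] for the condition at
    [0+], [pinfty_nbhs R] for the condition at [+oo]. *)
Definition sinai_condition (R : realType) (d : measure_display)
    (Omega : measurableType d) (P : probability Omega R)
    (sigma : R -> Omega -> \bar R) (F : set_system R) (beta : R) : Prop :=
  forall lambda : R, 1 < lambda ->
    (\int[lebesgue_measure]_(t in `]0%R, +oo[)
       ((t^-1)%R%:E *
        P [set w | z%:E < sigma t w <= (lambda * z)%R%:E]))%E @[z --> F]
    --> (beta * ln lambda)%:E.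

Definition regularly_varying (R : realType) (f : R -> R) (F : set_system R)
    (alpha : R) : Prop :=
  [/\ measurable_fun (`[0, +oo[ : set R) f,
      (forall x, 0 <= x -> 0 <= f x) &
      forall lambda : R, 0 < lambda ->
        f (lambda * x) / f x @[x --> F] --> lambda `^ alpha].

(* Main.v *)
Require Import Defs.
From HB Require Import structures.
From mathcomp Require Import all_boot all_order all_algebra.
From mathcomp Require Import all_classical all_reals all_analysis.
From mathcomp Require Import measurable_realfun.
From mathcomp Require Import ring lra.
Import Order.TTheory GRing.Theory Num.Theory.
Import numFieldNormedType.Exports.
Local Open Scope classical_set_scope.
Local Open Scope ring_scope.
Set Implicit Arguments.
Unset Strict Implicit.
Unset Printing Implicit Defensive.

(** Let [H_l (z)] be the integral of [P (z < sigma_t <= l z)] against [dt / t],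
    the quantity in Sinai's condition.  The proof rests on the identity
      [\int_0^oo p exp (- p z) H_l (z) dz = ln (phi p / phi (p / l))]
    ([laplace_harmonic_increment]).  At a fixed time [t], the formula
    [exp (- p x) = \int_x^oo p exp (- p z) dz], used for [x = sigma_t / l] and
    for [x = sigma_t], shows that the integral in [z] of
    [p exp (- p z) P (z < sigma_t <= l z)] is
    [exp (- t phi (p / l)) - exp (- t phi p)]; integrating against [dt / t] gives
    Frullani's integral.  The exponential form of the Laplace transform of
    [sigma_t] comes from the independence of the increments
    ([laplace_transformD], [laplace_transform_exp]).

    Hence regular variation of [phi] with index [beta] means that, for every
    [l > 1], the average of [H_l] under the exponential law of rate [p] tends to
    [beta ln l], whereas Sinai's condition says the same of [H_l] itself, at the
    scale [z] comparable to [1 / p].  The function [H_l] is bounded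
    ([harmonic_increment_le]), because [phi (l q) <= 4 l phi q].

    From values to averages, it is enough that the exponential law of rate [p]
    is concentrated at the scale [1 / p] ([cvg_kernel_average]).

    From averages to values, averages against
    [exp (- (j + 1) s) (1 - exp (- s)) ^ n] are linear combinations of
    exponential averages at the rates [k p], so they converge too
    ([cvg_kernel_average_beta]).  For [j = n] large, these kernels concentrate at
    [s = ln 2] ([beta_kernel_concentrates]).  Since the interval from [z] to
    [l z] is contained in the one from [y] to [m y] as soon as [y <= z] and
    [l z <= m y], the value [H_l (z)] lies, up to negligible tails, between
    averages of [H_(l / th ^ 2)] and [H_(l th ^ 2)] around [z], and [th] is
    arbitrarily close to [1] ([tauberian_increments]). *)

(** * Elementary integrals of exponentials *)

Section exponential_integrals.
Context {R : realType}.
Local Notation mu := (@lebesgue_measure R).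
Implicit Types p a b : R.

Lemma continuous_expRMn p : continuous (fun x : R => expR (- (p * x))).
Proof.
move=> x; apply: (@continuous_comp _ _ _ (fun x : R => - (p * x)) expR); last exact: continuous_expR.
apply: (@continuousN _ R^o); apply: mulrl_continuous.
Qed.

Lemma measurable_expRMn p D : measurable_fun D (fun x : R => expR (- (p * x))).
Proof.
apply: measurable_funTS; exact: (continuous_measurable_fun (@continuous_expRMn p)).
Qed.

Lemma is_derive_expRMn p (x : R) :
  is_derive x 1 (fun x : R => - expR (- (p * x))) (p * expR (- (p * x))).
Proof.
apply: is_derive_eq.
rewrite /GRing.scale/=; ring.
Qed.

Lemma integral_expRMny p a : 0 < p ->
  (\int[mu]_(x in `]a, +oo[) (p * expR (- (p * x)))%:E
   = (expR (- (p * a)))%:E)%E.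
Proof.
move=> p0.
have cf : continuous (fun x : R => p * expR (- (p * x))).
  by move=> x; apply: cvgM; [exact: cvg_cst|exact: continuous_expRMn].
rewrite integral_itv_obnd_cbnd; last first.
  by apply/measurable_EFinP/measurable_funM => //; exact: measurable_expRMn.
rewrite (@ge0_continuous_FTC2y _ _ (fun x => - expR (- (p * x))) _ 0).
- by rewrite EFinN oppeK add0e.
- by move=> x _; rewrite mulr_ge0 ?expR_ge0// ltW.
- exact: continuous_subspaceT.
- rewrite -oppr0; apply: cvgN.
  apply: (@cvg_comp _ _ _ (fun z : R => p * z) (fun z : R => expR (- z))); last exact: cvgr_expR.
  exact: gt0_cvgMry.
- move=> x _; exact: (@ex_derive _ _ _ _ _ _ _ (is_derive_expRMn p x)).
- by apply: cvgN; apply/cvg_at_right_filter; exact: continuous_expRMn.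
- by move=> x _; rewrite derive1E (@derive_val _ _ _ _ _ _ _ (is_derive_expRMn p x)).
Qed.

Lemma integral_expRMn p a b : a < b ->
  (\int[mu]_(x in `[a, b]) (p * expR (- (p * x)))%:E
   = (expR (- (p * a)) - expR (- (p * b)))%:E)%E.
Proof.
move=> ab.
have cf : continuous (fun x : R => p * expR (- (p * x))).
  by move=> x; apply: cvgM; [exact: cvg_cst|exact: continuous_expRMn].
rewrite (@continuous_FTC2 _ _ (fun x => - expR (- (p * x)))).
- by rewrite -EFinB opprK addrC.
- by [].
- exact: continuous_subspaceT.
- split.
  + move=> x _; exact: (@ex_derive _ _ _ _ _ _ _ (is_derive_expRMn p x)).
  + by apply: cvgN; apply/cvg_at_right_filter; exact: continuous_expRMn.
  + by apply: cvgN; apply/cvg_at_left_filter; exact: continuous_expRMn.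
- by move=> x _; rewrite derive1E (@derive_val _ _ _ _ _ _ _ (is_derive_expRMn p x)).
Qed.

Lemma integral_invr a b : 0 < a -> a < b ->
  (\int[mu]_(x in `[a, b]) (x^-1)%:E = (ln (b / a))%:E)%E.
Proof.
move=> a0 ab; have b0 : 0 < b by exact: lt_trans ab.
have cln x : 0 < x -> {for x, continuous (@ln R)} by exact: continuous_ln.
rewrite (@continuous_FTC2 _ _ (@ln R)).
- by rewrite -EFinB ln_div.
- by [].
- apply: continuous_in_subspaceT => x /[!inE]/=; rewrite in_itv/= => /andP[ax _].
  by apply: cvgV; [rewrite gt_eqF// (lt_le_trans a0)|exact: cvg_id].
- split.
  + move=> x; rewrite in_itv/= => /andP[ax _].
    exact: (@ex_derive _ _ _ _ _ _ _ (is_derive1_ln (lt_trans a0 ax))).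
  + by apply/cvg_at_right_filter; exact: cln.
  + by apply/cvg_at_left_filter; exact: cln.
- move=> x; rewrite in_itv/= => /andP[ax _].
  by rewrite derive1E (@derive_val _ _ _ _ _ _ _ (is_derive1_ln (lt_trans a0 ax))).
Qed.

End exponential_integrals.

(** * Exponential averages and dual scales *)

Section exponential_averages.
Context {R : realType}.
Local Notation mu := (@lebesgue_measure R).
Local Notation D := (`]0%R, +oo[%classic : set R).
Implicit Types (p a b C : R) (f h W : R -> R).

Lemma integrable_expRMny p a : 0 < p ->
  mu.-integrable `]a, +oo[ (EFin \o (fun z => p * expR (- (p * z)))).
Proof.
move=> p0; apply/integrableP; split.
  by apply/measurable_EFinP/measurable_funM => //; exact: measurable_expRMn.
under eq_integral do rewrite /= ger0_norm ?mulr_ge0 ?expR_ge0 ?ltW//.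
by rewrite integral_expRMny// ltry.
Qed.

Lemma integrable_le_expRM f p C : 0 < p -> measurable_fun D f ->
  (forall z, 0 < z -> `|f z| <= C * (p * expR (- (p * z)))) ->
  mu.-integrable D (EFin \o f).
Proof.
move=> p0 mf fC; have := @integrableZl _ _ _ mu _ (measurable_itv `]0, +oo[) C _ (integrable_expRMny 0 p0).
apply: le_integrable => //; first exact/measurable_EFinP.
move=> z /=; rewrite in_itv/= andbT => z0.
rewrite lee_fin (le_trans (fC _ z0))//; exact: ler_norm.
Qed.

Lemma Rintegral_expRMny p a : 0 < p ->
  \int[mu]_(z in `]a, +oo[) (p * expR (- (p * z))) = expR (- (p * a)).
Proof. by move=> p0; rewrite /Rintegral integral_expRMny. Qed.

Lemma integrable_scaler A r f : measurable A ->
  mu.-integrable A (EFin \o f) -> mu.-integrable A (EFin \o (fun z => r * f z)).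
Proof. by move=> mA; exact: integrableZl. Qed.

(** With [W s = exp (- s)] this is the mean of [h] under the exponential law of
    rate [p]; a general kernel [W] is seen at the scale [1 / p]. *)
Definition kernel_average W h p := \int[mu]_(z in `]0, +oo[) (p * W (p * z) * h z).

Definition bounded_measurable h C :=
  measurable_fun D h /\ forall z, 0 < z -> `|h z| <= C.

(** The bound by [exp (- s)] makes the averages of bounded functions finite,
    and lets tails be measured by the exponential law. *)
Definition exponential_kernel W :=
  measurable_fun setT W /\ forall s, 0 < s -> `|W s| <= expR (- s).

Lemma integrable_kernel_average W h C p : 0 < p -> exponential_kernel W ->
  bounded_measurable h C ->
  mu.-integrable D (EFin \o (fun z => p * W (p * z) * h z)).
Proof.
move=> p0 [mW W1] [mh hC]; apply: (@integrable_le_expRM _ p C) => //.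
  apply: measurable_funM => //; apply: measurable_funM => //.
  apply: measurableT_comp => //; apply: measurable_funM => //.
move=> z z0; rewrite !normrM mulrC ler_pM//; first exact: hC.
by rewrite (gtr0_norm p0) ler_pM2l// W1// mulr_gt0.
Qed.

Lemma exponential_kernel_expRN : exponential_kernel (fun s => expR (- s)).
Proof.
split; last by move=> s _; rewrite ger0_norm ?expR_ge0.
by apply: measurableT_comp => //; exact: measurable_funN.
Qed.

Lemma bounded_measurable_cst C : bounded_measurable (cst C) `|C|.
Proof. by split => //; exact: measurable_cst. Qed.

Lemma kernel_average_expRN_cst C p : 0 < p ->
  kernel_average (fun s => expR (- s)) (cst C) p = C.
Proof.
move=> p0; rewrite /kernel_average/=.
rewrite RintegralZr//; first by rewrite Rintegral_expRMny// mulr0 oppr0 expR0 mul1r.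
exact: integrable_expRMny.
Qed.

Lemma kernel_averageB W h h' C C' p : 0 < p -> exponential_kernel W ->
  bounded_measurable h C -> bounded_measurable h' C' ->
  kernel_average W (h \- h') p = kernel_average W h p - kernel_average W h' p.
Proof.
move=> p0 kW bh bh'; rewrite -RintegralB//.
- by apply: eq_Rintegral => z _; rewrite /= mulrBr.
- exact: integrable_kernel_average bh.
- exact: integrable_kernel_average bh'.
Qed.

Lemma kernel_averageZ W c h C p : 0 < p -> exponential_kernel W ->
  bounded_measurable h C ->
  kernel_average W (fun z => c * h z) p = c * kernel_average W h p.
Proof.
move=> p0 kW bh; rewrite -RintegralZl//.
- by apply: eq_Rintegral => z _; rewrite /= mulrCA.
- exact: integrable_kernel_average bh.
Qed.

(** The exponential law of rate [p] gives mass [1 - exp (- p dl)] to [0, dl]. *)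
Lemma ler_kernel_average_split g C p dl a b : 0 < p -> 0 < dl ->
  bounded_measurable g C ->
  (forall z, 0 < z <= dl -> `|g z| <= a) -> (forall z, dl < z -> `|g z| <= b) ->
  `|kernel_average (fun s => expR (- s)) g p|
  <= a * (1 - expR (- (p * dl))) + b * expR (- (p * dl)).
Proof.
move=> p0 dl0 bg ga gb.
pose k z := p * expR (- (p * z)).
have k0 z : 0 <= k z by rewrite mulr_ge0 ?expR_ge0 ?ltW.
have ig := integrable_kernel_average p0 exponential_kernel_expRN bg.
apply: (le_trans (le_normr_Rintegral _ ig)) => //.
have {}ig : mu.-integrable D (EFin \o (fun z => `|k z * g z|)).
  exact: (integrable_norm ig).
have DE : D = `]0, dl]%classic `|` `]dl, +oo[%classic.
  by rewrite -itv_bndbnd_setU//; rewrite bnd_simp ltW.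
have ik : mu.-integrable D (EFin \o k) by exact: integrable_expRMny.
have i1 (f : R -> R) : mu.-integrable D (EFin \o f) -> mu.-integrable `]0, dl] (EFin \o f).
  by apply: integrableS => //; rewrite DE; exact: subsetUl.
have i2 (f : R -> R) : mu.-integrable D (EFin \o f) -> mu.-integrable `]dl, +oo[ (EFin \o f).
  by apply: integrableS => //; rewrite DE; exact: subsetUr.
have disj : [disjoint `]0, dl]%classic & `]dl, +oo[%classic].
  apply/disj_setPS => z [] /=; rewrite !in_itv/= andbT => /andP[_ zd] dz.
  by have := lt_le_trans dz zd; rewrite ltxx.
have E : \int[mu]_(z in `]0, dl]) k z = 1 - expR (- (p * dl)).
  have := @Rintegral_setU _ _ _ mu `]0, dl] `]dl, +oo[ k.
  rewrite -DE => /(_ _ _ ik disj) H.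
  move: H; rewrite !Rintegral_expRMny// mulr0 oppr0 expR0 => -> //.
  by rewrite addrK.
rewrite {1}DE Rintegral_setU//; last by rewrite -DE.
rewrite lerD//.
  rewrite -E -RintegralZl//; last exact: i1.
  apply: le_Rintegral => //; [exact: i1|by apply: integrable_scaler => //; exact: i1|].
  move=> z /=; rewrite in_itv/= => zd.
  by rewrite normrM (ger0_norm (k0 _)) mulrC ler_wpM2r// ga.
rewrite -(Rintegral_expRMny dl p0) -RintegralZl//; last exact: i2.
apply: le_Rintegral => //; [exact: i2|by apply: integrable_scaler => //; exact: i2|].
move=> z /=; rewrite in_itv/= andbT => zd.
by rewrite normrM (ger0_norm (k0 _)) mulrC ler_wpM2r// gb.
Qed.

(** Here [F] is the filter of the scale [z] and [G] that of the rate [p]; the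
    two correspond through [z = c / p].  The field [dual_conc] says that under
    [G] the exponential law of rate [p] is concentrated on any given set of
    [F]: a function bounded by [C], and by [e] on that set, has a small
    average.  The definition allows zero and infinity to be treated at once. *)
Record dual_scales (F G : set_system R) : Prop := DualScales {
  dual_proper_l : ProperFilter F ;
  dual_proper_r : ProperFilter G ;
  dual_pos_l : \forall z \near F, 0 < z ;
  dual_pos_r : \forall p \near G, 0 < p ;
  dual_lr : forall c, 0 < c -> c / z @[z --> F] --> G ;
  dual_rl : forall c, 0 < c -> c / p @[p --> G] --> F ;
  dual_conc : forall (S : set R) e C, F S -> 0 < e -> 0 < C ->
    \forall p \near G, forall g, bounded_measurable g C ->
      (forall z, 0 < z -> S z -> `|g z| <= e) ->
      `|kernel_average (fun s => expR (- s)) g p| <= e *+ 2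
}.

Lemma dual_scale_mul F G : dual_scales F G ->
  forall c, 0 < c -> c * p @[p --> G] --> G.
Proof.
move=> FG c c0; have [PF PG _ _ lr rl _] := FG.
have := cvg_comp _ _ (rl _ ltr01) (lr _ c0).
apply: cvg_trans; apply: near_eq_cvg; near=> p => /=.
by rewrite div1r invrK.
Unshelve. all: by end_near. Qed.

(** Abelian direction: the exponential law of rate [p] lives where [h] is
    already close to its limit. *)
Lemma cvg_kernel_average (F G : set_system R) h C (c : R) : dual_scales F G ->
  bounded_measurable h C -> h z @[z --> F] --> (c : R) ->
  kernel_average (fun s => expR (- s)) h p @[p --> G] --> c.
Proof.
move=> FG [mh hC] hc; have [PF PG posl posr lr rl conc] := FG.
have C0 : 0 <= C by exact: le_trans (hC 1 ltr01).
apply/cvgrPdist_le => e e0.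
have e20 : 0 < e / 2 by rewrite divr_gt0.
move/cvgrPdist_le : hc => /(_ _ e20) hc.
have K0 : 0 < C + `|c| + 1 by rewrite ltr_wpDl// addr_ge0.
have := conc _ _ _ hc e20 K0.
apply: filterS2 posr => p p0 /(_ (h \- cst c)) H.
rewrite distrC -[X in _ - X](kernel_average_expRN_cst c p0).
rewrite -(kernel_averageB p0 exponential_kernel_expRN (conj mh hC) (bounded_measurable_cst c)).
rewrite (splitr e) -mulr2n; apply: H => //.
  split; first exact: measurable_funB.
  move=> z z0; rewrite (le_trans (ler_normB _ _))//= -addrA lerD ?hC//.
  by rewrite lerDl.
by move=> z z0; rewrite distrC.
Qed.

Lemma at_right0P (S : set R) : ((0:R)^'+ : set_system R) S ->
  exists2 dl, 0 < dl & forall z, 0 < z <= dl -> S z.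
Proof.
move=> [e /= e0 He]; exists (e / 2); first by rewrite divr_gt0.
move=> z /andP[z0 ze]; apply: He => //=.
rewrite sub0r normrN gtr0_norm// (le_lt_trans ze)//.
by rewrite ltr_pdivrMr// ltr_pMr// ltr1n.
Qed.

Lemma pinfty_nbhsP (S : set R) : pinfty_nbhs R S ->
  exists2 M, 0 < M & forall z, M < z -> S z.
Proof.
move=> [M [_ MS]]; exists (Num.max M 1); first by rewrite lt_max ltr01 orbT.
by move=> z; rewrite gt_max => /andP[Mz _]; exact: MS.
Qed.

Lemma near_at_right0 (S : set R) dl : 0 < dl ->
  (forall z, 0 < z -> z < dl -> S z) -> ((0:R)^'+ : set_system R) S.
Proof.
move=> d0 H; exists dl => //= z /=; rewrite sub0r normrN => zd z0.
by apply: H => //; rewrite gtr0_norm in zd.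
Qed.

Lemma near_pinfty (S : set R) M : (forall z, M < z -> S z) -> pinfty_nbhs R S.
Proof. by move=> H; exists M; split => //; rewrite num_real. Qed.

Lemma cvg_div_at_right0 (c : R) : 0 < c -> c / z @[z --> (0:R)^'+] --> +oo%R.
Proof.
move=> c0 S /pinfty_nbhsP[M M0 MS].
apply: (@near_at_right0 _ (c / M)); first by rewrite divr_gt0.
move=> z z0 zM; apply: MS.
by rewrite ltr_pdivlMr// mulrC -ltr_pdivlMr.
Qed.

Lemma cvg_div_pinfty (c : R) : 0 < c -> c / p @[p --> +oo%R] --> ((0:R)^'+ : set_system R).
Proof.
move=> c0 S /at_right0P[dl dl0 dS].
apply: (@near_pinfty _ (c / dl)) => z cz.
have z0 : 0 < z by rewrite (lt_trans _ cz)// divr_gt0.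
apply: dS; rewrite divr_gt0//= ler_pdivrMr// mulrC -ler_pdivrMr//.
exact: ltW.
Qed.

(** As [p] grows, the mass [exp (- p dl)] beyond any [dl] vanishes. *)
Lemma dual_scales_0y : dual_scales (0:R)^'+ (pinfty_nbhs R).
Proof.
split; [exact: at_right_proper_filter|exact: proper_pinfty_nbhs|exact: (near_at_right0 ltr01)
  |exact: (@near_pinfty _ 0)|exact: cvg_div_at_right0|exact: cvg_div_pinfty|].
move=> S e C /at_right0P[dl dl0 dS] e0 C0.
(* beyond this rate, [C exp (- p dl) <= e] *)
apply: (@near_pinfty _ (C / e / dl)) => p pC.
have p0 : 0 < p by rewrite (lt_trans _ pC)// !divr_gt0.
move=> g bg gS; apply: (le_trans (@ler_kernel_average_split g C p dl e C p0 dl0 bg _ _)).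
- by move=> z /andP[z0 zd]; apply: gS => //; apply: dS; rewrite z0.
- by move=> z zd; apply: bg.2; exact: lt_trans zd.
rewrite mulr2n lerD//.
  by apply: ler_piMr; [exact: ltW|rewrite gerBl expR_ge0].
have pd : C / e < p * dl by rewrite -ltr_pdivrMr.
rewrite expRN ler_pdivrMr ?expR_gt0// mulrC -ler_pdivrMr//.
apply: (le_trans (ltW pd)); rewrite (le_trans _ (expR_ge1Dx _))//.
by rewrite lerDr.
Qed.

(** As [p] vanishes, so does the mass [1 - exp (- p M)] below any [M]. *)
Lemma dual_scales_y0 : dual_scales (pinfty_nbhs R) (0:R)^'+.
Proof.
split; [exact: proper_pinfty_nbhs|exact: at_right_proper_filter|
  exact: (@near_pinfty _ 0)|exact: (near_at_right0 ltr01)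
  |exact: cvg_div_pinfty|exact: cvg_div_at_right0|].
move=> S e C /pinfty_nbhsP[M M0 MS] e0 C0.
(* below this rate, [C (1 - exp (- p M)) <= e] *)
apply: (@near_at_right0 _ (e / C / M)); first by rewrite !divr_gt0.
move=> p p0 pC.
move=> g bg gS; apply: (le_trans (@ler_kernel_average_split g C p M C e p0 M0 bg _ _)).
- by move=> z /andP[z0 zd]; exact: bg.2.
- by move=> z zd; apply: gS; [exact: lt_trans zd|exact: MS].
rewrite mulr2n lerD//.
  have pd : p * M < e / C by rewrite -ltr_pdivlMr.
  rewrite mulrC -ler_pdivlMr// (le_trans _ (ltW pd))//.
  by rewrite lerBlDr addrC -lerBlDr; exact: expR_ge1Dx.
apply: ler_piMr; first exact: ltW.
by rewrite expR_le1 oppr_le0 mulr_ge0// ltW.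
Qed.

End exponential_averages.

(** * Beta kernels *)

Section beta_kernels.
Context {R : realType}.
Local Notation mu := (@lebesgue_measure R).
Local Notation D := (`]0%R, +oo[%classic : set R).
Local Notation E := (fun s : R => expR (- s)).
Implicit Types (n j : nat) (h : R -> R) (p C : R).

(** Up to normalization, the law of [s] for which [exp (- s)] has the Beta law
    of parameters [j + 1] and [n + 1].  Being a polynomial in [exp (- s)]
    without constant term, it is a combination of exponential kernels. *)
Definition beta_kernel n j (s : R) := expR (- (j.+1%:R * s)) * (1 - expR (- s)) ^+ n.

(** The total mass [j! n! / (j + n + 1)!] of the kernel, in the form that the
    recursion on kernels provides. *)
Fixpoint beta_mass n j : R :=
  if n is n'.+1 then beta_mass n' j - beta_mass n' j.+1 else j.+1%:R^-1.

(** Thanks to this identity, statements on Beta kernels follow by induction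
    from the purely exponential case, and no binomial expansion is needed. *)
Lemma beta_kernelS n j s :
  beta_kernel n.+1 j s = beta_kernel n j s - beta_kernel n j.+1 s.
Proof.
rewrite /beta_kernel; have -> : expR (- (j.+2%:R * s)) = expR (- (j.+1%:R * s)) * expR (- s).
  by rewrite -expRD -opprD -[X in _ + X]mul1r -mulrDl -natr1.
by rewrite exprS; ring.
Qed.

Lemma exponential_kernel_beta n j : exponential_kernel (beta_kernel n j).
Proof.
split.
  apply: measurable_funM; first exact: measurable_expRMn.
  apply: measurable_funX; apply: measurable_funB => //.
  by apply: measurableT_comp => //; exact: measurable_funN.
move=> s s0; have u1 : expR (- s) <= 1 by rewrite expR_le1 oppr_le0 ltW.
rewrite normrM (ger0_norm (expR_ge0 _)) normrX ger0_norm ?subr_ge0//.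
apply: (@le_trans _ _ (expR (- s) * 1)); last by rewrite mulr1.
apply: ler_pM => //.
- by apply: exprn_ge0; rewrite subr_ge0.
- by rewrite ler_expR lerN2; apply: ler_peMl; [exact: ltW|rewrite ler1n].
- by apply: exprn_ile1; rewrite ?subr_ge0// gerBl expR_ge0.
Qed.

Lemma kernel_average_beta0 j h p :
  kernel_average (beta_kernel 0 j) h p
  = fine (\int[mu]_(z in `]0, +oo[) (j.+1%:R^-1 * (j.+1%:R * p * E (j.+1%:R * p * z) * h z))%:E).
Proof.
apply: eq_Rintegral => z _; rewrite /beta_kernel expr0 mulr1.
have j0 : j.+1%:R != 0 :> R by rewrite pnatr_eq0.
by rewrite -!mulrA mulKf.
Qed.

Lemma kernel_average_beta0_scale j h C p : 0 < p -> bounded_measurable h C ->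
  kernel_average (beta_kernel 0 j) h p
  = j.+1%:R^-1 * kernel_average E h (j.+1%:R * p).
Proof.
move=> p0 bh; rewrite kernel_average_beta0 -RintegralZl//.
by apply: (integrable_kernel_average _ exponential_kernel_expRN bh); rewrite mulr_gt0.
Qed.

Lemma kernel_average_betaS n j h C p : 0 < p -> bounded_measurable h C ->
  kernel_average (beta_kernel n.+1 j) h p
  = kernel_average (beta_kernel n j) h p - kernel_average (beta_kernel n j.+1) h p.
Proof.
move=> p0 bh; rewrite -RintegralB//.
- by apply: eq_Rintegral => z _; rewrite beta_kernelS mulrBr mulrBl.
- exact: (integrable_kernel_average p0 (exponential_kernel_beta _ _) bh).
- exact: (integrable_kernel_average p0 (exponential_kernel_beta _ _) bh).
Qed.

Lemma kernel_average_beta_cst1 n j p : 0 < p ->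
  kernel_average (beta_kernel n j) (cst 1) p = beta_mass n j.
Proof.
move=> p0; elim: n j => [|n IH] j.
  rewrite (kernel_average_beta0_scale _ p0 (bounded_measurable_cst 1)).
  by rewrite kernel_average_expRN_cst ?mulr1// mulr_gt0.
by rewrite (kernel_average_betaS _ _ p0 (bounded_measurable_cst 1)) !IH.
Qed.

Lemma kernel_average_beta_cst n j a p : 0 < p ->
  kernel_average (beta_kernel n j) (cst a) p = beta_mass n j * a.
Proof.
move=> p0; rewrite -(kernel_average_beta_cst1 n j p0) mulrC.
rewrite -(kernel_averageZ _ p0 (exponential_kernel_beta n j) (bounded_measurable_cst 1)).
by apply: eq_Rintegral => y _; rewrite /= mulr1.
Qed.

(** The average of [h] against [exp (- (j + 1) s)] at rate [p] is, up to the
    factor [1 / (j + 1)], the exponential average at rate [(j + 1) p], so it has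
    the same limit; the other kernels are differences of these. *)
Lemma cvg_kernel_average_beta (F G : set_system R) n j h C (c : R) :
  dual_scales F G -> bounded_measurable h C ->
  kernel_average E h p @[p --> G] --> c ->
  kernel_average (beta_kernel n j) h p @[p --> G] --> beta_mass n j * c.
Proof.
move=> FG bh hc; have [PF PG _ pos _ _ _] := FG.
elim: n j => [|n IH] j.
  have eqG : {near G, (fun p => j.+1%:R^-1 * kernel_average E h (j.+1%:R * p))
      =1 kernel_average (beta_kernel 0 j) h}.
    by apply: filterS pos => p p0; rewrite (kernel_average_beta0_scale _ p0 bh).
  apply: (cvg_trans (near_eq_cvg eqG)).
  apply: cvgM; first exact: cvg_cst.
  apply: (cvg_comp _ _ _ hc).
  by apply: (dual_scale_mul FG); rewrite ltr0n.
have eqG : {near G, (fun p => kernel_average (beta_kernel n j) h p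
    - kernel_average (beta_kernel n j.+1) h p) =1 kernel_average (beta_kernel n.+1 j) h}.
  by apply: filterS pos => p p0; rewrite (kernel_average_betaS _ _ p0 bh).
apply: (cvg_trans (near_eq_cvg eqG)).
by rewrite mulrBl; exact: cvgB.
Qed.

Lemma beta_kernel_diag n s :
  beta_kernel n n s = (expR (- s) * (1 - expR (- s))) ^+ n * expR (- s).
Proof.
rewrite /beta_kernel exprMn mulrAC; congr (_ * _).
by rewrite -expRM_natl -expRD -natr1 mulrDl mul1r mulrN opprD.
Qed.

(** On the set where [exp (- s)] is within [dl / 2] of [1 / 2], a set of
    mass [dl] for the exponential law, the product [u (1 - u)] with
    [u = exp (- s)] is at least [1 / 4 - (dl / 2) ^ 2]. *)
Lemma beta_mass_diag_ge n dl : 0 < dl < 1 / 2 ->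
  (1 / 4 - (dl / 2) ^+ 2) ^+ n * dl <= beta_mass n n.
Proof.
move=> /andP[d0 d1]; set m := 1 / 4 - _.
pose a := - ln (1 / 2 + dl / 2); pose b := - ln (1 / 2 - dl / 2).
have pa : 0 < 1 / 2 + dl / 2 by lra.
have pb : 0 < 1 / 2 - dl / 2 by lra.
have Ea : expR (- a) = 1 / 2 + dl / 2 by rewrite opprK lnK.
have Eb : expR (- b) = 1 / 2 - dl / 2 by rewrite opprK lnK.
have ab : a < b by rewrite -ltrN2 -ltr_expR Ea Eb; lra.
have a0 : 0 < a by rewrite -oppr_lt0 -expR_lt1 Ea; lra.
have m0 : 0 <= m by rewrite /m; nra.
have [mW W1] := exponential_kernel_beta n n.
have mW' : measurable_fun setT (fun z : R => 1 * beta_kernel n n (1 * z) * cst 1 z).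
  by apply: eq_measurable_fun mW => z _; rewrite /= mulr1 !mul1r.
have key : ((m ^+ n * dl)%:E <= \int[mu]_(z in `]0%R, +oo[) (1 * beta_kernel n n (1 * z) * cst 1 z)%:E)%E.
  apply: (@le_trans _ _ (\int[mu]_(z in `[a, b]) (m ^+ n * (1 * expR (- (1 * z))))%:E)%E).
    under eq_integral do rewrite EFinM.
    rewrite ge0_integralZl_EFin//; last 2 first.
    - by apply/measurable_EFinP/measurable_funM => //; exact: measurable_expRMn.
    - exact: exprn_ge0.
    rewrite integral_expRMn// !mul1r Ea Eb -EFinM lee_fin ler_wpM2l ?exprn_ge0//.
    lra.
  apply: (@le_trans _ _ (\int[mu]_(z in `[a, b]) (1 * beta_kernel n n (1 * z) * cst 1 z)%:E)%E).
    apply: ge0_le_integral => //.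
    - by move=> z _; rewrite lee_fin mul1r mulr_ge0 ?expR_ge0// exprn_ge0.
    - apply/measurable_EFinP/measurable_funM => //; apply/measurable_funM => //.
      exact: measurable_expRMn.
    - by apply/measurable_EFinP; exact: measurable_funTS.
    move=> z /=; rewrite in_itv/= => /andP[az zb].
    rewrite lee_fin !mul1r mulr1 beta_kernel_diag ler_wpM2r ?expR_ge0//.
    have ua : expR (- z) <= 1 / 2 + dl / 2 by rewrite -Ea ler_expR lerN2.
    have ub : 1 / 2 - dl / 2 <= expR (- z) by rewrite -Eb ler_expR lerN2.
    by apply: lerXn2r; rewrite ?nnegrE//; rewrite /m; nra.
  apply: ge0_subset_integral => //.
  - by apply/measurable_EFinP; exact: measurable_funTS.
  - move=> z /=; rewrite in_itv/= andbT => z0; rewrite lee_fin mul1r mul1r mulr1.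
    rewrite mulr_ge0 ?expR_ge0// exprn_ge0// subr_ge0 expR_le1 oppr_le0 ltW//.
  - by move=> z /=; rewrite !in_itv/= andbT => /andP[az _]; exact: lt_le_trans az.
rewrite -(kernel_average_beta_cst1 n n ltr01) -lee_fin fineK//.
have i1 := integrable_kernel_average ltr01 (exponential_kernel_beta n n)
  (bounded_measurable_cst 1).
exact: (integrable_fin_num _ i1).
Qed.

(** Away from [ln 2] the product [u (1 - u)], with [u = exp (- s)], stays below
    a constant smaller than [1 / 4], so that its powers are negligible with
    respect to the mass of the kernel.  The tail is bounded by a multiple of the
    exponential kernel, which is then easy to integrate against anything
    bounded. *)
Lemma beta_kernel_concentrates (th e : R) : 1 < th -> 0 < e ->
  exists n tau, [/\ 0 < beta_mass n n, 0 <= tau, tau <= e * beta_mass n n &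
    forall s, 0 < s -> ~~ (ln 2 / th <= s <= th * ln 2) ->
      beta_kernel n n s <= tau * expR (- s)].
Proof.
move=> th1 e0; have th0 : 0 < th by exact: lt_trans th1.
have l2 : 0 < ln 2 :> R by rewrite ln_gt0// ltr1n.
have E2 : expR (- ln 2) = 1 / 2 :> R by rewrite expRN lnK ?posrE// div1r.
(* values of [exp (- s)] at the end points of the neighbourhood of [ln 2] *)
pose u1 : R := expR (- (ln 2 / th)); pose u2 : R := expR (- (th * ln 2)).
have u1h : 1 / 2 < u1 by rewrite -E2 ltr_expR ltrN2 ltr_pdivrMr// ltr_pMr.
have u2h : u2 < 1 / 2 by rewrite -E2 ltr_expR ltrN2 ltr_pMl.
have u20 : 0 < u2 := expR_gt0 _.
pose dl := Num.min (u1 - 1 / 2) (1 / 2 - u2).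
have d1 : dl <= u1 - 1 / 2 by rewrite ge_min lexx.
have d2 : dl <= 1 / 2 - u2 by rewrite ge_min lexx orbT.
have d0 : 0 < dl by rewrite lt_min !subr_gt0 u1h.
have dh : dl < 1 / 2 by lra.
clearbody dl.
(* [M] bounds [u (1 - u)] outside of the neighbourhood, and [m] bounds it from
   below on a smaller one *)
pose M := 1 / 4 - dl ^+ 2; pose m := 1 / 4 - (dl / 2) ^+ 2.
have M0 : 0 <= M by rewrite /M; nra.
have mM : M < m by rewrite /M /m; nra.
have m0 : 0 < m by exact: le_lt_trans mM.
have r1 : `|M / m| < 1 by rewrite ger0_norm ?divr_ge0 ?(ltW m0)// ltr_pdivrMr// mul1r.
have ed : 0 < e * dl by rewrite mulr_gt0.
have /cvgrPdist_le/(_ _ ed)[n _ /(_ n (leqnn n))] := cvg_expr r1.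
rewrite sub0r normrN normrX ger0_norm ?divr_ge0 ?(ltW m0)// expr_div_n ler_pdivrMr ?exprn_gt0// => Hn.
have mge := beta_mass_diag_ge n (introT andP (conj d0 dh)).
exists n, (M ^+ n); split.
- by apply: lt_le_trans mge; rewrite mulr_gt0// exprn_gt0.
- exact: exprn_ge0.
- apply: (le_trans Hn); rewrite -mulrA ler_pM2l// mulrC.
  exact: mge.
move=> s s0 sJ; rewrite beta_kernel_diag ler_wpM2r ?expR_ge0//.
have u0 : 0 < expR (- s) := expR_gt0 _.
have us : expR (- s) < 1 by rewrite expR_lt1 oppr_lt0.
apply: lerXn2r; rewrite ?nnegrE//; first by nra.
rewrite negb_and -!ltNge in sJ; case/orP: sJ => sJ.
  have : u1 < expR (- s) by rewrite ltr_expR ltrN2.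
  by rewrite /M; nra.
have : expR (- s) < u2 by rewrite ltr_expR ltrN2.
by rewrite /M; nra.
Qed.

End beta_kernels.

(** * The Tauberian argument *)

Section tauberian.
Context {R : realType}.
Local Notation D := (`]0%R, +oo[%classic : set R).
Local Notation E := (fun s : R => expR (- s)).

(** Comparing [f] and [g] only where the kernel lives costs a multiple of its
    tail [tau]. *)
Lemma ler_kernel_average_beta n (tau th p C Cf Cg : R) (f g : R -> R) :
  0 < p -> 0 <= tau -> 0 <= C ->
  (forall s, 0 < s -> ~~ (ln 2 / th <= s <= th * ln 2) ->
      beta_kernel n n s <= tau * expR (- s)) ->
  bounded_measurable f Cf -> bounded_measurable g Cg ->
  (forall z, 0 < z -> ln 2 / th <= p * z <= th * ln 2 -> f z <= g z) ->
  (forall z, 0 < z -> 0 <= g z) -> (forall z, 0 < z -> 0 <= f z <= C) ->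
  kernel_average (beta_kernel n n) f p
  <= kernel_average (beta_kernel n n) g p + C * tau.
Proof.
move=> p0 tau0 C0 conc bf bg fg g0 fC.
have kW := @exponential_kernel_beta R n n.
have ik := integrable_kernel_average p0 exponential_kernel_expRN (bounded_measurable_cst (C * tau)).
have i_g := integrable_kernel_average p0 kW bg.
rewrite -[X in _ <= _ + X](kernel_average_expRN_cst (C * tau) p0) -RintegralD//.
apply: le_Rintegral => //; first exact: (integrable_kernel_average p0 kW bf).
  exact: (integrableD _ i_g ik).
move=> z /=; rewrite in_itv/= andbT => z0.
have s0 : 0 < p * z by rewrite mulr_gt0.
have W0 : 0 <= beta_kernel n n (p * z).
  by rewrite mulr_ge0 ?expR_ge0// exprn_ge0// subr_ge0 expR_le1 oppr_le0 ltW.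
have [f0 fCz] := andP (fC _ z0).
have := conc _ s0; move: (beta_kernel n n (p * z)) W0 => w w0 cs.
rewrite -!mulrA -mulrDr ler_pM2l//.
case: (boolP (ln 2 / th <= p * z <= th * ln 2)) => sJ.
  apply: ler_wpDr; first by rewrite !mulr_ge0 ?expR_ge0.
  by apply: ler_wpM2l => //; exact: fg.
apply: ler_wpDl; first by rewrite mulr_ge0 ?g0.
rewrite mulrC mulrCA mulrA -mulrA; apply: ler_pM => //.
by rewrite mulrC; exact: cs.
Qed.

Variables (F G : set_system R) (h : R -> R -> R) (beta : R).
Hypothesis FG : dual_scales F G.
Hypothesis h_bounded : forall l, 1 < l -> exists C, bounded_measurable (h l) C.
Hypothesis h_ge0 : forall l z, 1 < l -> 0 < z -> 0 <= h l z.
Hypothesis h_mono : forall l m z y, 1 < l -> 1 < m -> 0 < y -> y <= z ->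
  l * z <= m * y -> h l z <= h m y.
Hypothesis h_cvg : forall l, 1 < l ->
  kernel_average E (h l) p @[p --> G] --> beta * ln l.

Lemma bounded_measurable_ge0 l : 1 < l ->
  exists C, [/\ 0 <= C, bounded_measurable (h l) C & forall z, 0 < z -> 0 <= h l z <= C].
Proof.
move=> l1; have [C hC] := h_bounded l1; exists C; split => //.
  exact: le_trans (hC.2 1 ltr01).
move=> z z0; rewrite h_ge0//=; exact: le_trans (ler_norm _) (hC.2 _ z0).
Qed.

(** With [p = th ln 2 / z], the kernel charges the interval from [z / th ^ 2] to
    [z], on which the monotonicity of the family bounds [h (l th ^ 2)] below
    by [h l z].  The average of the former tends to
    [beta (ln l + 2 ln th)], close to [beta ln l] when [th] is close to [1]. *)
Lemma tauberian_limsup l e : 1 < l -> 0 < e ->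
  \forall z \near F, h l z <= beta * ln l + e.
Proof.
move=> l1 e0; have [PF PG pos _ lr _ _] := FG.
have l0 : 0 < l by exact: lt_trans l1.
(* so that [beta ln (th ^ 2) <= e / 2] *)
pose eta := e / (4 * (`|beta| + 1)).
have b1 : 0 < `|beta| + 1 by rewrite ltr_wpDl.
have eta0 : 0 < eta by rewrite divr_gt0// mulr_gt0.
have th1 : 1 < expR eta by rewrite expR_gt1.
set th := expR eta in th1 *; have th0 : 0 < th := expR_gt0 _.
have m1 : 1 < l * th ^+ 2.
  apply: (lt_le_trans l1); apply: ler_peMr; first exact: ltW.
  by apply: exprn_ege1; exact: ltW.
have lnm : ln (l * th ^+ 2) = ln l + 2 * eta.
  by rewrite lnM ?posrE ?exprn_gt0// lnXn// expRK mulr_natl.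
have [C [C0 bC hC]] := bounded_measurable_ge0 l1.
have [C' [_ bC' hC']] := bounded_measurable_ge0 m1.
have e1 : 0 < e / 4 / (C + 1) by rewrite !divr_gt0// ltr_wpDl.
(* with this precision the tail costs at most [e / 4] times the mass *)
have [n [tau [mass0 tau0 taum conc]]] := beta_kernel_concentrates th1 e1.
have e2 : 0 < beta_mass n n * (e / 4) by rewrite mulr_gt0// divr_gt0.
have l2 : 0 < ln 2 :> R by rewrite ln_gt0// ltr1n.
have := @cvg_kernel_average_beta _ _ _ n n _ _ _ FG bC' (h_cvg m1).
have thl : 0 < th * ln 2 by rewrite mulr_gt0.
move=> /(cvg_comp _ _ (lr _ thl))/cvgrPdist_le/(_ _ e2).
apply: filterS2 pos => z z0 /=; set p := th * ln 2 / z.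
have p0 : 0 < p by rewrite divr_gt0.
rewrite distrC => /(le_trans (ler_norm _)) H.
have hz := hC _ z0; have [hz0 hzC] := andP hz.
have : kernel_average (beta_kernel n n) (cst (h l z)) p
    <= kernel_average (beta_kernel n n) (h (l * th ^+ 2)) p + C * tau.
  apply: (ler_kernel_average_beta p0 tau0 C0 conc (bounded_measurable_cst _) bC') => //.
    move=> y y0 /andP[y1 y2]; apply: h_mono => //.
      by move: y2; rewrite /p mulrAC ler_pdivrMr// ler_pM2l.
    rewrite -mulrA ler_pM2l// expr2.
    move: y1; rewrite /p ler_pdivrMr// (_ : _ * y * th = ln 2 * (th * th * y / z)); last by ring.
    by rewrite ler_pMr// ler_pdivlMr// mul1r.
  by move=> y y0; case/andP: (hC' _ y0).
rewrite kernel_average_beta_cst// => H2; rewrite -(ler_pM2l mass0).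
apply: (le_trans H2); move: H; rewrite lerBlDr => H; apply: (le_trans (lerD H (lexx _))).
rewrite lnm.
have Ct : C * tau <= beta_mass n n * (e / 4).
  apply: (@le_trans _ _ (C * (e / 4 / (C + 1) * beta_mass n n))).
    by rewrite ler_wpM2l.
  rewrite [leRHS]mulrC mulrA ler_pM2r// mulrCA; apply: ler_piMr.
    by rewrite ltW// divr_gt0.
  by rewrite ler_pdivrMr ?ltr_wpDl// mul1r lerDl.
have be : beta * (2 * eta) <= e / 2.
  apply: (@le_trans _ _ ((`|beta| + 1) * (2 * eta))).
    rewrite ler_pM2r ?mulr_gt0// (le_trans (ler_norm _))// lerDl//.
  rewrite /eta le_eqVlt; apply/orP; left; apply/eqP; field.
  by rewrite gt_eqF.
nra.
Qed.

(** Symmetrically, with [p = ln 2 / (th z)] the kernel charges the interval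
    from [z] to [th ^ 2 z], on which [h (l / th ^ 2)] is at most [h l z]. *)
Lemma tauberian_liminf l e : 1 < l -> 0 < e ->
  \forall z \near F, beta * ln l - e <= h l z.
Proof.
move=> l1 e0; have [PF PG pos _ lr _ _] := FG.
have l0 : 0 < l by exact: lt_trans l1.
have b1 : 0 < `|beta| + 1 by rewrite ltr_wpDl.
have ll : 0 < ln l by rewrite ln_gt0.
(* the first bound ensures [1 < l / th ^ 2], the second
   [beta ln (th ^ 2) <= e / 2] *)
pose eta := Num.min (ln l / 4) (e / (4 * (`|beta| + 1))).
have eta0 : 0 < eta by rewrite lt_min !divr_gt0// mulr_gt0.
have etal : eta <= ln l / 4 by rewrite ge_min lexx.
have etae : eta <= e / (4 * (`|beta| + 1)) by rewrite ge_min lexx orbT.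
clearbody eta.
have th1 : 1 < expR eta by rewrite expR_gt1.
set th := expR eta in th1 *; have th0 : 0 < th := expR_gt0 _.
have th20 : 0 < th ^+ 2 by rewrite exprn_gt0.
have lnm : ln (l / th ^+ 2) = ln l - 2 * eta.
  by rewrite ln_div ?posrE// lnXn// expRK mulr_natl.
have m1 : 1 < l / th ^+ 2.
  by rewrite -ltr_ln ?posrE ?divr_gt0// ln1 lnm; lra.
have [C [C0 bC hC]] := bounded_measurable_ge0 m1.
have e1 : 0 < e / 4 / (C + 1) by rewrite !divr_gt0// ltr_wpDl.
(* with this precision the tail costs at most [e / 4] times the mass *)
have [n [tau [mass0 tau0 taum conc]]] := beta_kernel_concentrates th1 e1.
have e2 : 0 < beta_mass n n * (e / 4) by rewrite mulr_gt0// divr_gt0.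
have l2 : 0 < ln 2 :> R by rewrite ln_gt0// ltr1n.
have := @cvg_kernel_average_beta _ _ _ n n _ _ _ FG bC (h_cvg m1).
have thl : 0 < ln 2 / th by rewrite divr_gt0.
move=> /(cvg_comp _ _ (lr _ thl))/cvgrPdist_le/(_ _ e2).
apply: filterS2 pos => z z0 /=; set p := ln 2 / th / z.
have p0 : 0 < p by rewrite divr_gt0.
move=> /(le_trans (ler_norm _)) H.
have hz0 := h_ge0 l1 z0.
have : kernel_average (beta_kernel n n) (h (l / th ^+ 2)) p
    <= kernel_average (beta_kernel n n) (cst (h l z)) p + C * tau.
  apply: (ler_kernel_average_beta p0 tau0 C0 conc bC (bounded_measurable_cst _)) => //.
  move=> y y0 /andP[y1 y2]; apply: h_mono => //.
    by move: y1; rewrite /p mulrAC ler_pdivlMr// ler_pM2l.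
  rewrite -mulrA ler_pM2l// ler_pdivrMl// expr2.
  move: y2; rewrite /p (_ : _ * y = ln 2 * (y / z / th)); last by ring.
  by rewrite mulrC ler_pM2r// !ler_pdivrMr.
rewrite kernel_average_beta_cst// => H2; rewrite -(ler_pM2l mass0).
have Ct : C * tau <= beta_mass n n * (e / 4).
  apply: (@le_trans _ _ (C * (e / 4 / (C + 1) * beta_mass n n))).
    by rewrite ler_wpM2l.
  rewrite [leRHS]mulrC mulrA ler_pM2r// mulrCA; apply: ler_piMr.
    by rewrite ltW// divr_gt0.
  by rewrite ler_pdivrMr ?ltr_wpDl// mul1r lerDl.
have be : beta * (2 * eta) <= e / 2.
  apply: (@le_trans _ _ ((`|beta| + 1) * (2 * eta))).
    rewrite ler_pM2r ?mulr_gt0// (le_trans (ler_norm _))// lerDl//.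
  move: etae; rewrite ler_pdivlMr ?mulr_gt0//; lra.
move: H; rewrite lnm; nra.
Qed.

(** For a single function, the convergence of exponential averages does not
    imply that of the function.  Here [h l z] behaves like
    the mass that a measure gives to the interval from [z] to [l z]: enlarging
    the interval increases the value, and this replaces the monotonicity
    hypothesis of classical Tauberian theorems. *)
Theorem tauberian_increments l : 1 < l -> h l z @[z --> F] --> beta * ln l.
Proof.
move=> l1; have [PF _ _ _ _ _ _] := FG; apply/cvgrPdist_le => e e0.
apply: filterS2 (tauberian_limsup l1 e0) (tauberian_liminf l1 e0) => z H1 H2.
by rewrite ler_distlC lerBlDr H1 andbT -lerBlDr.
Qed.

End tauberian.

(** * Laplace transforms by layers *)

Section layer_cake.
Context {R : realType} {d : measure_display} {Omega : measurableType d}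
  (P : probability Omega R).
Local Notation mu := (@lebesgue_measure R).
Local Notation D := (`]0%R, +oo[%classic : set R).
Implicit Types (q y : R) (x : \bar R).

(** The function [exp (- q x)] with value [0] at [x = +oo], including for
    [q = 0], where it is the indicator of survival. *)
Definition laplace_kernel q x : R := (x < +oo)%E%:R * expR (- (q * fine x)).

Lemma laplace_kernel_ge0 q x : 0 <= laplace_kernel q x.
Proof. by rewrite mulr_ge0 ?expR_ge0. Qed.

Lemma laplace_kernel_le1 q x : 0 <= q -> (0 <= x)%E -> laplace_kernel q x <= 1.
Proof.
move=> q0; case: x => [r| |] //= r0; rewrite /laplace_kernel.
  by rewrite ltry mul1r expR_le1 oppr_le0 mulr_ge0.
by rewrite ltxx mul0r.
Qed.

Lemma measurable_bool_indic d' (T : measurableType d') (b : T -> bool) :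
  measurable [set z | b z] -> measurable_fun setT (fun z => (b z)%:R : R).
Proof.
move=> mb; rewrite (_ : (fun _ => _) = \1_[set z | b z]); first exact: measurable_indic.
by apply/funext => z; rewrite indicE mem_setE.
Qed.

Lemma measurable_laplace_kernel q : measurable_fun setT (laplace_kernel q).
Proof.
apply: measurable_funM.
  apply: measurable_bool_indic.
  rewrite -[X in measurable X]setTI; apply: measurable_lte => //.
apply: measurableT_comp => //; apply: measurable_funN => //.
by apply: measurable_funM => //; exact: measurable_fine.
Qed.

Lemma laplace_kernelD q x (y' : \bar R) : (0 <= x)%E -> (0 <= y')%E ->
  laplace_kernel q (x + y') = laplace_kernel q x * laplace_kernel q y'.
Proof.
case: x y' => [r| |] [s| |] // r0 s0; rewrite /laplace_kernel/= ?ltry ?ltxx ?mul0r ?mulr0//.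
by rewrite !mul1r mulrDr opprD expRD.
Qed.

Lemma laplace_kernel_integral q x : 0 < q -> (0 <= x)%E ->
  (\int[mu]_(y in D) ((x <= y%:E)%E%:R * (q * expR (- (q * y))))%:E
   = (laplace_kernel q x)%:E)%E.
Proof.
move=> q0; case: x => [r| |] //; last first.
  move=> _; rewrite /laplace_kernel ltxx mul0r.
  by apply: integral0_eq => y _; rewrite leye_eq mul0r.
rewrite lee_fin => r0; rewrite /laplace_kernel ltry mul1r /=.
rewrite -(integral_expRMny r q0).
transitivity (\int[mu]_(y in D `&` `[r, +oo[) (q * expR (- (q * y)))%:E)%E.
  rewrite integral_mkcondr; apply: eq_integral => y _.
  rewrite /patch mem_setE in_itv/= andbT lee_fin.
  by case: ifP; rewrite ?mul1r ?mul0r.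
have mf (A : set R) : measurable_fun A (fun y => (q * expR (- (q * y)))%:E).
  by apply/measurable_EFinP/measurable_funM => //; exact: measurable_expRMn.
have [->|rn0] := eqVneq r 0.
  rewrite (_ : D `&` _ = D)//; apply/seteqP; split => y /=; rewrite !in_itv/= !andbT.
    by case.
  by move=> y0; split => //; exact: ltW.
rewrite [RHS]integral_itv_obnd_cbnd//.
rewrite (_ : D `&` _ = `[r, +oo[%classic)//.
apply/seteqP; split => y /=; rewrite !in_itv/= !andbT; first by case.
by move=> ry; split => //; apply: lt_le_trans ry; rewrite lt_def rn0.
Qed.

(** Fubini applied to [exp (- q x) = \int_(x <= y) q exp (- q y) dy].  The
    weight [k] makes it possible to apply the formula to two random variables
    in turn, and thereby to bring their joint law down to probabilities of
    events. *)
Lemma layer_cake q (X : Omega -> \bar R) (k : Omega -> R) : 0 < q ->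
  measurable_fun setT X -> measurable_fun setT k -> (forall w, 0 <= k w) ->
  (forall w, k w = 0 \/ (0 <= X w)%E) ->
  (\int[P]_w (laplace_kernel q (X w) * k w)%:E
   = \int[mu]_(y in D) ((q * expR (- (q * y)))%:E
       * \int[P]_w ((X w <= y%:E)%E%:R * k w)%:E))%E.
Proof.
move=> q0 mX mk k0 kX.
pose f (z : Omega * R) : \bar R :=
  ((0 < z.2)%R%:R * (q * expR (- (q * z.2))) * ((X z.1 <= z.2%:E)%E%:R * k z.1))%:E.
have mf : measurable_fun setT f.
  apply/measurable_EFinP/measurable_funM; apply: measurable_funM.
  - apply: measurable_bool_indic; rewrite -[X in measurable X]setTI.
    under eq_set do rewrite -lte_fin.
    by apply: measurable_lte => //; apply/measurable_EFinP; exact: measurable_snd.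
  - apply: measurable_funM => //.
    apply: measurableT_comp => //; apply: measurable_funN => //.
    by apply: measurable_funM => //; exact: measurable_snd.
  - apply: measurable_bool_indic; rewrite -[X in measurable X]setTI.
    apply: measurable_lee => //; first exact: (measurableT_comp mX measurable_fst).
    by apply/measurable_EFinP; exact: measurable_snd.
  - exact: (measurableT_comp mk measurable_fst).
have f0 z : (0 <= f z)%E.
  by rewrite lee_fin !mulr_ge0// ?expR_ge0// ltW.
have := @fubini_tonelli _ _ _ _ _ P mu f mf f0.
have -> : (\int[P]_w \int[mu]_y f (w, y) = \int[P]_w (laplace_kernel q (X w) * k w)%:E)%E.
  apply: eq_integral => w _.
  transitivity (\int[mu]_(y in D) ((k w)%:E * ((X w <= y%:E)%E%:R * (q * expR (- (q * y))))%:E))%E.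
    rewrite [RHS]integral_mkcond; apply: eq_integral => y _.
    rewrite /patch mem_setE in_itv/= andbT /f /=.
    case: (0 < y); last by rewrite !mul0r.
    by rewrite mul1r -EFinM mulrCA [in RHS]mulrCA [k w * _]mulrC.
  rewrite ge0_integralZl_EFin//; last 2 first.
  - by move=> y _; rewrite lee_fin !mulr_ge0// ?expR_ge0// ltW.
  - apply/measurable_EFinP; apply: measurable_funM.
      apply: measurable_funTS; apply: measurable_bool_indic.
      by rewrite -[X in measurable X]setTI; apply: measurable_lee => //; exact/measurable_EFinP.
    by apply: measurable_funM => //; exact: measurable_expRMn.
  have [->|Xw0] := kX w; first by rewrite mul0e mulr0.
  by rewrite laplace_kernel_integral// -EFinM mulrC.
move=> ->; rewrite [RHS]integral_mkcond; apply: eq_integral => y _.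
rewrite /patch mem_setE in_itv/= andbT /f /=.
case: ltP => y0; last by rewrite integral0_eq// => w _; rewrite !mul0r.
rewrite -ge0_integralZl_EFin//.
- by apply: eq_integral => w _; rewrite -EFinM mul1r.
- by move=> w _; rewrite lee_fin mulr_ge0.
- apply/measurable_EFinP; apply: measurable_funM => //.
  apply: measurable_bool_indic.
  by rewrite -[X in measurable X]setTI; apply: measurable_lee => //; exact/measurable_EFinP.
- by rewrite mulr_ge0// ?expR_ge0// ltW.
Qed.

Lemma layer_cake1 q (X : Omega -> \bar R) : 0 < q ->
  measurable_fun setT X -> (forall w, (0 <= X w)%E) ->
  (\int[P]_w (laplace_kernel q (X w))%:E
   = \int[mu]_(y in D) ((q * expR (- (q * y)))%:E
       * P [set w | (X w <= y%:E)%E]))%E.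
Proof.
move=> q0 mX X0.
have H := @layer_cake q X (cst 1) q0 mX.
under eq_integral do rewrite -[laplace_kernel _ _]mulr1.
rewrite H//; last by move=> w; right.
apply: eq_integral => y _; congr (_ * _)%E.
have mS : measurable [set w | (X w <= y%:E)%E].
  by rewrite -[X in measurable X]setTI; apply: measurable_lee.
rewrite -[in RHS](setIT [set w | _]) -integral_indic//; apply: eq_integral => w _.
by rewrite indicE mulr1 mem_setE.
Qed.

End layer_cake.

(** * Multiplicativity of the Laplace transform in time *)

Section subordinator_facts.
Context {R : realType} {d : measure_display} {Omega : measurableType d}
  {P : probability Omega R} {sigma : R -> Omega -> \bar R}.
Hypothesis hsigma : subordinator P sigma.
Local Notation mu := (@lebesgue_measure R).
Local Notation D := (`]0%R, +oo[%classic : set R).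
Implicit Types (q s t y : R) (w : Omega).

Lemma subordinator_ge0 t w : 0 <= t -> (0 <= sigma t w)%E.
Proof.
move=> t0; rewrite -(sub_start hsigma w).
exact: (sub_nondecreasing hsigma).
Qed.

(** By right continuity the process is already infinite at its lifetime. *)
Lemma lt_lifetime t w : 0 <= t -> (t%:E < lifetime sigma w)%E = (sigma t w < +oo)%E.
Proof.
move=> t0; apply/idP/idP => [tl|].
  rewrite ltey; apply/eqP => st.
  have : (lifetime sigma w <= t%:E)%E by apply: ereal_inf_lbound; exists t.
  by rewrite leNgt tl.
apply: contraTT; rewrite -leNgt => lt.
have sy u : t < u -> sigma u w = +oo%E.
  move=> tu; have : (lifetime sigma w < u%:E)%E by apply: le_lt_trans lt _; rewrite lte_fin.
  move=> /ereal_inf_lt[_ [v [v0 sv] <-]]; rewrite lte_fin => vu.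
  by apply/eqP; rewrite -leye_eq -sv; apply: (sub_nondecreasing hsigma) => //; exact: ltW.
have := sub_right_continuous hsigma (w:=w) t0.
have : sigma u w @[u --> t^'+] --> +oo%E.
  have eqt : {near t^'+, (fun=> +oo%E : \bar R) =1 sigma ^~ w}.
    by near=> u; rewrite sy.
  by apply: (cvg_trans (near_eq_cvg eqt)); exact: cvg_cst.
by move=> /(cvg_unique (@ereal_hausdorff R)) H /H <-; rewrite ltxx.
Unshelve. all: by end_near. Qed.

Lemma measurable_subordinator t : 0 <= t -> measurable_fun setT (sigma t).
Proof. exact: (sub_measurable hsigma). Qed.

Definition laplace_transform q t := \int[P]_w laplace_kernel q (sigma t w).
Local Notation L := laplace_transform.

Lemma measurable_laplace_kernel_sigma q t : 0 <= t ->
  measurable_fun setT (fun w => laplace_kernel q (sigma t w)).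
Proof.
move=> t0; apply: (measurableT_comp (@measurable_laplace_kernel R q)).
exact: measurable_subordinator.
Qed.

Lemma integrable_laplace_kernel q t : 0 <= q -> 0 <= t ->
  P.-integrable setT (EFin \o (fun w => laplace_kernel q (sigma t w))).
Proof.
move=> q0 t0; apply: (@le_integrable _ _ _ _ _ measurableT _ (cst 1%E)).
- by apply/measurable_EFinP; exact: measurable_laplace_kernel_sigma.
- move=> w _; rewrite /= lee_fin normr1 ger0_norm ?laplace_kernel_ge0//.
  by apply: laplace_kernel_le1 => //; exact: subordinator_ge0.
- exact: finite_measure_integrable_cst.
Qed.

Lemma laplace_transformE q t : 0 <= q -> 0 <= t ->
  (\int[P]_w (laplace_kernel q (sigma t w))%:E = (L q t)%:E)%E.
Proof.
by move=> q0 t0; rewrite fineK// (integrable_fin_num _ (integrable_laplace_kernel q0 t0)).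
Qed.

Lemma measurable_cdf_subordinator t : 0 <= t ->
  measurable_fun setT (fun y => P [set w | (sigma t w <= y%:E)%E]).
Proof.
move=> t0.
have mS y : measurable [set w | (sigma t w <= y%:E)%E].
  rewrite -[X in measurable X]setTI; apply: measurable_lee => //.
  exact: measurable_subordinator.
have : measurable_fun setT (fun y => fine (P [set w | (sigma t w <= y%:E)%E])).
  apply: nondecreasing_measurable => // y z yz.
  apply: fine_le; [exact: fin_num_measure|exact: fin_num_measure|].
  apply: le_measure; rewrite ?inE// => w /= /le_trans; apply.
  by rewrite lee_fin.
move=> /measurable_EFinP; apply: eq_measurable_fun => y _.
by rewrite /= fineK// fin_num_measure.
Qed.

Lemma laplace_transform_layers q t : 0 < q -> 0 <= t ->
  ((L q t)%:E = \int[mu]_(y in D) ((q * expR (- (q * y)))%:E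
      * P [set w | (sigma t w <= y%:E)%E]))%E.
Proof.
move=> q0 t0; rewrite -laplace_transformE ?(ltW q0)//.
apply: layer_cake1 => //; first exact: measurable_subordinator.
by move=> w; exact: subordinator_ge0.
Qed.

Lemma laplace_transform_le1 q t : 0 <= q -> 0 <= t -> L q t <= 1.
Proof.
move=> q0 t0; apply: (@le_trans _ _ (\int[P]_w cst 1 w)).
  apply: le_Rintegral => //; first exact: integrable_laplace_kernel.
    exact: finite_measure_integrable_cst.
  by move=> w _; apply: laplace_kernel_le1 => //; exact: subordinator_ge0.
rewrite Rintegral_cst// mul1r.
have : fine (P setT) <= 1 by rewrite probability_setT.
exact: le_trans.
Qed.

Lemma laplace_transform_ge0 q t : 0 <= L q t.
Proof. by apply: Rintegral_ge0 => w _; exact: laplace_kernel_ge0. Qed.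

(** On survival at [t], [sigma_(t+s)] is the sum of [sigma_t] and of an
    increment.  Layering both terms reduces the claim to the factorization of
    [P (sigma_t <= y, increment <= z)], which is the defining property of the
    increments. *)
Lemma laplace_transformD q s t : 0 < q -> 0 <= s -> 0 <= t ->
  L q (t + s) = L q t * L q s.
Proof.
move=> q0 s0 t0; have st0 : 0 <= t + s by rewrite addr_ge0.
have q0' := ltW q0.
have ms := measurable_subordinator s0; have mt := measurable_subordinator t0.
have mst := measurable_subordinator st0.
pose A := [set w | (sigma t w < +oo)%E].
have mA : measurable A by rewrite -[X in measurable X]setTI; exact: measurable_lte.
pose Y w := (sigma (t + s) w - sigma t w)%E.
have mY : measurable_fun setT Y by exact: emeasurable_funB.
have mU y (X : Omega -> \bar R) : measurable_fun setT X -> measurable [set w | (X w <= y%:E)%E].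
  by move=> mX; rewrite -[X in measurable X]setTI; exact: measurable_lee.
have Y0 w : A w -> (0 <= Y w)%E.
  rewrite /A/= => stw; rewrite /Y sube_ge0.
    by apply: (sub_nondecreasing hsigma) => //; rewrite lerDl.
  by rewrite ge0_fin_numE ?subordinator_ge0// stw.
pose k w : R := (sigma t w < +oo)%E%:R * laplace_kernel q (Y w).
have mk : measurable_fun setT k.
  apply: measurable_funM; first exact: measurable_bool_indic.
  exact: (measurableT_comp (@measurable_laplace_kernel R q)).
have k0 w : 0 <= k w by rewrite mulr_ge0// laplace_kernel_ge0.
apply: EFin_inj; rewrite EFinM -[LHS]laplace_transformE//.
transitivity (\int[P]_w (laplace_kernel q (sigma t w) * k w)%:E)%E.
  apply: eq_integral => w _; congr EFin; rewrite /k.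
  case: (boolP (sigma t w < +oo)%E) => stw; last first.
    have stE : sigma t w = +oo%E by apply/eqP; rewrite -leye_eq leNgt.
    have -> : sigma (t + s) w = +oo%E.
      by apply/eqP; rewrite -leye_eq -stE; apply: (sub_nondecreasing hsigma) => //; rewrite lerDl.
    by rewrite /laplace_kernel ltxx !mul0r mulr0.
  rewrite mul1r -laplace_kernelD ?subordinator_ge0 ?Y0//.
  by rewrite /Y addeC subeK// ge0_fin_numE ?subordinator_ge0.
rewrite layer_cake//; last by move=> w; right; exact: subordinator_ge0.
have inner y : (\int[P]_w ((sigma t w <= y%:E)%E%:R * k w)%:E
    = P [set w | (sigma t w <= y%:E)%E] * (L q s)%:E)%E.
  pose k' w : R := (sigma t w <= y%:E)%E%:R.
  have mk' : measurable_fun setT k' by apply: measurable_bool_indic; exact: mU.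
  transitivity (\int[P]_w (laplace_kernel q (Y w) * k' w)%:E)%E.
    apply: eq_integral => w _; rewrite /k /k'; congr EFin.
    case: (boolP (sigma t w <= y%:E)%E) => sy; last by rewrite mul0r mulr0.
    by rewrite (le_lt_trans sy) ?ltry// !mul1r mulr1.
  rewrite layer_cake//; last first.
    move=> w; rewrite /k'; case: (boolP (sigma t w <= y%:E)%E) => sy; last by left.
    by right; apply: Y0; rewrite /A/= (le_lt_trans sy) ?ltry.
  rewrite laplace_transform_layers// -ge0_integralZl//; last 2 first.
  - apply: emeasurable_funM.
      by apply/measurable_EFinP/measurable_funM => //; exact: measurable_expRMn.
    exact: measurable_funTS (measurable_cdf_subordinator s0).
  - by move=> z _; rewrite mule_ge0// lee_fin mulr_ge0 ?expR_ge0.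
  apply: eq_integral => z _; rewrite muleCA; congr (_ * _)%E.
  have := @sub_increments _ _ _ _ _ hsigma s t
    [set w | (sigma t w <= y%:E)%E] [set x | (x <= z%:E)%E] s0 t0.
  have -> : [set w | (sigma t w <= y%:E)%E] `&` [set w | (t%:E < lifetime sigma w)%E]
      = [set w | (sigma t w <= y%:E)%E].
    apply/setIidPl => w /= sy; rewrite lt_lifetime// (le_lt_trans sy)// ltry//.
  move=> H; rewrite -[RHS]H; last 2 first.
  - apply: sub_sigma_algebra; exists t, [set x | (x <= y%:E)%E]; split => //.
      by rewrite t0 lexx.
    by rewrite -[X in measurable X]setTI; exact: measurable_lee.
  - by rewrite -[X in measurable X]setTI; exact: measurable_lee.
  rewrite -[X in P X]setIT -integral_indic//; last by apply: measurableI; exact: mU.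
  apply: eq_integral => w _; congr EFin; rewrite /k' indicE.
  have -> : (w \in [set w | (sigma t w <= y%:E)%E]
      `&` [set w | [set x | (x <= z%:E)%E] (sigma (t + s) w - sigma t w)%E])
      = (sigma t w <= y%:E)%E && (Y w <= z%:E)%E.
    by apply/idP/andP => [/set_mem[]//|[? ?]]; exact/mem_set.
  by case: (sigma t w <= _)%E; case: (Y w <= _)%E; rewrite ?mulr1 ?mulr0.
under eq_integral do rewrite inner muleA.
rewrite ge0_integralZr//.
- by rewrite -laplace_transform_layers.
- apply: emeasurable_funM.
    by apply/measurable_EFinP/measurable_funM => //; exact: measurable_expRMn.
  exact: measurable_funTS (measurable_cdf_subordinator t0).
- by move=> y _; rewrite mule_ge0// lee_fin mulr_ge0 ?expR_ge0.
- by rewrite lee_fin laplace_transform_ge0.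
Qed.

End subordinator_facts.

(** * The Laplace exponent *)

(** Comparing [F (n t)] with [F] at the neighbouring integers gives
    [n |F t - t F 1| <= F 1] for every [n]. *)
Lemma additive_monotone_linear (R : realType) (F : R -> R) :
  (forall s t, 0 <= s -> 0 <= t -> F (t + s) = F t + F s) ->
  (forall s t, 0 <= s -> s <= t -> F s <= F t) ->
  forall t, 0 <= t -> F t = t * F 1.
Proof.
move=> FD Fnd t t0.
have F0 : F 0 = 0 by have /eqP := FD 0 0 (lexx 0) (lexx 0); rewrite addr0 -subr_eq subrr eq_sym => /eqP.
have Fn n s : 0 <= s -> F (n%:R * s) = n%:R * F s.
  move=> s0; elim: n => [|n IH]; first by rewrite !mul0r.
  by rewrite -natr1 !mulrDl !mul1r FD ?IH// mulr_ge0.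
have F1 : 0 <= F 1 by rewrite -F0 Fnd.
have bound n : n%:R * `|F t - t * F 1| <= F 1.
  (* both [n F t] and [n t F 1] lie between [k F 1] and [(k + 1) F 1] *)
  pose k := Num.truncn (n%:R * t).
  have nt0 : 0 <= n%:R * t by rewrite mulr_ge0.
  have /andP[k1 k2] : k%:R <= n%:R * t < k.+1%:R by rewrite truncn_itv.
  have l1 : k%:R * F 1 <= n%:R * F t.
    by rewrite -Fn// -Fn// mulr1 Fnd.
  have l2 : n%:R * F t <= k.+1%:R * F 1.
    by rewrite -Fn// -Fn// mulr1 Fnd// ltW.
  have l3 : k%:R * F 1 <= n%:R * (t * F 1) by rewrite mulrA ler_wpM2r.
  have l4 : n%:R * (t * F 1) <= k.+1%:R * F 1 by rewrite mulrA ler_wpM2r// ltW.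
  rewrite -[n%:R in X in X <= _]normr_nat -normrM mulrBr ler_norml.
  rewrite -natr1 mulrDl mul1r in l2 l4.
  by apply/andP; split; lra.
apply/eqP; rewrite -subr_eq0 -normr_le0 leNgt; apply/negP => e0.
have := bound (Num.truncn (F 1 / `|F t - t * F 1|)).+1.
apply/negP; rewrite -ltNge -ltr_pdivrMr//.
exact: truncnS_gt.
Qed.

Section laplace_exponent_facts.
Context {R : realType} {d : measure_display} {Omega : measurableType d}
  {P : probability Omega R} {sigma : R -> Omega -> \bar R}.
Hypothesis hsigma : subordinator P sigma.
Implicit Types (q s t y l : R) (w : Omega).
Local Notation L := (@laplace_transform R d Omega P sigma).
Local Notation phi := (laplace_exponent P sigma).

Lemma laplace_exponentE q : phi q = - ln (L q 1).
Proof.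
rewrite /laplace_exponent Rintegral_mkcond; congr (- ln _).
apply: eq_Rintegral => w _; rewrite /patch /laplace_kernel.
have -> : (w \in [set w | (1%:E < lifetime sigma w)%E]) = (sigma 1 w < +oo)%E.
  by rewrite -(lt_lifetime hsigma w ler01); apply/idP/idP => [/set_mem|/mem_set].
by case: ifP => _; rewrite ?mul1r ?mul0r.
Qed.

Lemma laplace_transform_nonincr_time q s t : 0 <= q -> 0 <= s -> s <= t -> L q t <= L q s.
Proof.
move=> q0 s0 st; have t0 : 0 <= t by exact: le_trans st.
apply: le_Rintegral => //; [exact: integrable_laplace_kernel|exact: integrable_laplace_kernel|].
move=> w _; have := sub_nondecreasing hsigma w s0 st.
have := subordinator_ge0 hsigma w s0.
rewrite /laplace_kernel; case: (sigma s w) (sigma t w) => [a| |] [b| |] //=.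
- by rewrite !ltry !mul1r !lee_fin ler_expR lerN2 => _ ab; rewrite ler_wpM2l.
- by rewrite ?ltxx mul0r mulr_ge0 ?expR_ge0.
Qed.

Lemma laplace_transform_nonincr q q' t : 0 <= q -> q <= q' -> 0 <= t -> L q' t <= L q t.
Proof.
move=> q0 qq t0; have q'0 : 0 <= q' by exact: le_trans qq.
apply: le_Rintegral => //; [exact: integrable_laplace_kernel|exact: integrable_laplace_kernel|].
move=> w _; have := subordinator_ge0 hsigma w t0.
rewrite /laplace_kernel; case: (sigma t w) => [a| |] //=.
  by rewrite ltry !mul1r lee_fin ler_expR lerN2 => a0; rewrite ler_wpM2r.
by rewrite ?ltxx !mul0r.
Qed.

Lemma laplace_transform0 q : 0 <= q -> L q 0 = 1.
Proof.
move=> q0; transitivity (\int[P]_w cst (1 : R) w).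
  apply: eq_Rintegral => w _; rewrite (sub_start hsigma) /laplace_kernel /=.
  by rewrite ltry mul1r mulr0 oppr0 expR0.
rewrite Rintegral_cst// mul1r.
have : fine (P setT) = 1 by rewrite probability_setT.
by apply: etrans.
Qed.

(** Otherwise the process would almost surely be infinite at all the times
    [1 / (n + 1)], against right continuity at [0]. *)
Lemma laplace_transform_gt0_near0 q : 0 <= q -> exists2 t, 0 < t & 0 < L q t.
Proof.
move=> q0; apply: contrapT => H.
have H' n : P.-negligible [set w | (sigma n.+1%:R^-1 w < +oo)%E].
  have n0 : 0 <= n.+1%:R^-1 :> R by [].
  have Ln : L q n.+1%:R^-1 = 0.
    apply/eqP; rewrite eq_le laplace_transform_ge0 andbT leNgt; apply/negP => L0.
    by apply: H; exists n.+1%:R^-1.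
  have := laplace_transformE hsigma q0 n0; rewrite Ln => Z.
  have m := measurable_laplace_kernel_sigma hsigma q n0.
  have /ae_eq_integral_abs : measurable_fun setT (EFin \o (fun w => laplace_kernel q (sigma n.+1%:R^-1 w))).
    exact/measurable_EFinP.
  move=> /(_ P measurableT)[+ _] => /(_ _)[|].
    rewrite -[RHS]Z; apply: eq_integral => w _ /=.
    by rewrite ger0_norm ?laplace_kernel_ge0.
  move=> N [mN PN sN]; exists N; split => // w /= sw; apply: sN => H0.
  have /eqP := EFin_inj (H0 I); rewrite /laplace_kernel sw mul1r; apply/negP.
  by rewrite gt_eqF ?expR_gt0.
have : P.-negligible (\bigcup_n [set w | (sigma n.+1%:R^-1 w < +oo)%E]).
  exact: negligible_bigcup.
(* right continuity at time [0], where the process vanishes *)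
have -> : \bigcup_n [set w | (sigma n.+1%:R^-1 w < +oo)%E] = setT.
  apply/seteqP; split => // w _.
  have := sub_right_continuous hsigma (w:=w) (lexx 0).
  rewrite (sub_start hsigma) => /fine_cvgP[[e /= e0 He] _].
  have : exists n, n.+1%:R^-1 < e.
    exists (Num.truncn e^-1); rewrite -[ltRHS]invrK ltf_pV2 ?posrE ?invr_gt0//.
    exact: truncnS_gt.
  move=> [n ne]; exists n => //=.
  have := He n.+1%:R^-1; rewrite /= sub0r normrN ger0_norm// => /(_ ne).
  rewrite invr_gt0 ltr0n => /(_ isT).
  by rewrite ge0_fin_numE// (subordinator_ge0 hsigma).
move=> /negligibleP => /(_ measurableT) PT.
by have /eqP := etrans (esym (probability_setT P)) PT; rewrite onee_eq0.
Qed.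

Lemma laplace_transform_gt0 q t : 0 <= q -> 0 <= t -> 0 < L q t.
Proof.
(* at rate [0], compare with a positive rate, for which the transform is
   multiplicative in time *)
move=> q0 t0; suff H q' : 0 < q' -> 0 < L q' t.
  have := H (q + 1) (ltr_wpDl q0 ltr01) => /lt_le_trans; apply.
  by apply: laplace_transform_nonincr => //; rewrite lerDl.
move=> {}q0; have [s s0 Ls] := laplace_transform_gt0_near0 (ltW q0).
have Ln n : 0 < L q' (n%:R * s).
  elim: n => [|n IH]; first by rewrite mul0r laplace_transform0// ltW.
  rewrite -natr1 mulrDl mul1r (laplace_transformD hsigma)// ?mulr_gt0//.
  - exact: ltW.
  - by rewrite mulr_ge0// ltW.
apply: (lt_le_trans (Ln (Num.truncn (t / s)).+1)).
apply: laplace_transform_nonincr_time => //; first exact: ltW.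
by rewrite -ler_pdivrMr// ltW// truncnS_gt.
Qed.

(** The logarithm of the Laplace transform is additive and monotone in time. *)
Lemma laplace_transform_exp q t : 0 < q -> 0 <= t -> L q t = expR (- (t * phi q)).
Proof.
move=> q0 t0; pose F u := - ln (L q u).
have Lp u : 0 <= u -> L q u \is Num.pos.
  by move=> u0; rewrite posrE laplace_transform_gt0// ltW.
have FE : F t = t * F 1.
  apply: additive_monotone_linear; [move=> u v u0 v0|move=> u v u0 uv|exact: t0].
    by rewrite /F (laplace_transformD hsigma)// lnM ?Lp// opprD.
  have v0 : 0 <= v by exact: le_trans uv.
  rewrite lerN2 ler_ln ?Lp//.
  by apply: laplace_transform_nonincr_time => //; exact: ltW.
by rewrite laplace_exponentE -/(F 1) -FE opprK lnK ?Lp.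
Qed.

Lemma laplace_exponent_ge0 q : 0 <= q -> 0 <= phi q.
Proof.
move=> q0; rewrite laplace_exponentE oppr_ge0 -[leRHS]ln1 ler_ln ?posrE ?laplace_transform_gt0//.
exact: laplace_transform_le1.
Qed.

Lemma laplace_exponent_nondecr q q' : 0 <= q -> q <= q' -> phi q <= phi q'.
Proof.
move=> q0 qq; have q'0 : 0 <= q' by exact: le_trans qq.
rewrite !laplace_exponentE lerN2 ler_ln ?posrE ?laplace_transform_gt0//.
exact: laplace_transform_nonincr.
Qed.

Lemma measurable_laplace_exponent : measurable_fun (`[0, +oo[ : set R) phi.
Proof.
have : measurable_fun (`[0, +oo[ : set R) (fun q => phi (Num.max 0 q)).
  apply: nondecreasing_measurable; first exact: measurable_itv.
  move=> a b ab; apply: laplace_exponent_nondecr; first by rewrite le_max lexx.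
  by rewrite ge_max le_max lexx /= le_max ab orbT.
apply: eq_measurable_fun => q; rewrite inE/= in_itv/= andbT => q0.
by rewrite max_r.
Qed.

(** If [phi q = 0] then [exp (- q sigma_t)] has mean [1] for all [t], which
    forces [sigma_t = 0] almost surely. *)
Lemma laplace_exponent_gt0 q :
  (exists2 t : R, 0 <= t & ~ {ae P, forall w, sigma t w = 0%E}) ->
  0 < q -> 0 < phi q.
Proof.
move=> [t t0 nz] q0; rewrite lt_def laplace_exponent_ge0 ?ltW// andbT.
apply/eqP => phi0; apply: nz.
have L1 : L q t = 1 by rewrite laplace_transform_exp// phi0 mulr0 oppr0 expR0.
have m := measurable_laplace_kernel_sigma hsigma q t0.
pose f w := 1 - laplace_kernel q (sigma t w).
have f0 w : 0 <= f w.
  rewrite subr_ge0; apply: laplace_kernel_le1; first exact: ltW.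
  exact: (subordinator_ge0 hsigma).
have mf : measurable_fun setT f by exact: measurable_funB.
have /ae_eq_integral_abs : measurable_fun setT (EFin \o f) by exact/measurable_EFinP.
move=> /(_ P measurableT)[+ _] => /(_ _)[|].
  transitivity (\int[P]_w (f w)%:E)%E.
    by apply: eq_integral => w _ /=; rewrite ger0_norm.
  have := laplace_transformE hsigma (ltW q0) t0.
  rewrite L1 => H.
  have := @integralB_EFin _ _ _ P setT (cst 1) (fun w => laplace_kernel q (sigma t w)) measurableT.
  have ik := integrable_laplace_kernel hsigma (ltW q0) t0.
  move=> /(_ (finite_measure_integrable_cst _ _ measurableT) ik).
  rewrite /= H => ->.
  have -> : (\int[P]_x 1 = 1)%E.
    rewrite integral_cst// mul1e; exact: probability_setT.
  by rewrite subee.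
move=> N [mN PN sN]; exists N; split => // w /= sw; apply: sN => /= H; apply: sw.
have /eqP := EFin_inj (H I); rewrite /f subr_eq0 => /eqP.
have := subordinator_ge0 hsigma w t0.
rewrite /laplace_kernel; case: (sigma t w) => [a| |] //=; last first.
  by rewrite ?ltxx mul0r => _ /eqP; rewrite oner_eq0.
rewrite ltry mul1r lee_fin => a0; rewrite -[1]expR0 => /expR_inj/esym/eqP.
rewrite oppr_eq0 mulf_eq0 gt_eqF//=.
by move=> /eqP ->.
Qed.

(** A cheap form of the concavity of [1 - exp (- a)]: the factor [2] leaves
    room to use only [exp a >= 1 + a]. *)
Lemma onem_expRN_le (l a : R) : 1 <= l -> 0 <= a ->
  1 - expR (- (l * a)) <= 2 * l * (1 - expR (- a)).
Proof.
move=> l1 a0.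
have h1 : a / (1 + a) <= 1 - expR (- a).
  rewrite lerBrDr -lerBrDl expRN.
  have -> : 1 - a / (1 + a) = (1 + a)^-1 by field; rewrite gt_eqF// ltr_pwDl.
  by rewrite lef_pV2 ?posrE ?expR_gt0 ?ltr_pwDl// expR_ge1Dx.
have h2 : 1 - expR (- (l * a)) <= l * a.
  by rewrite lerBlDr addrC -lerBlDr; exact: expR_ge1Dx.
have h3 : 1 - expR (- (l * a)) <= 1 by rewrite gerBl expR_ge0.
have a1 : 0 < 1 + a by rewrite ltr_pwDl.
have E : a / (1 + a) * (1 + a) = a by rewrite divfK// gt_eqF.
have x0 : 0 <= a / (1 + a) by rewrite divr_ge0// ltW.
move: (a / (1 + a)) (1 - expR (- a)) (1 - expR (- (l * a))) h1 h2 h3 E x0 => x y z h1 h2 h3 E x0.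
have : 2 * l * x <= 2 * l * y by rewrite ler_pM2l//; lra.
apply: le_trans.
have [la|la] := leP a 1.
  apply: (le_trans h2); rewrite mulrAC [leRHS]mulrC ler_pM2l; nra.
have x2 : 1 <= 2 * x by nra.
apply: (le_trans h3); nra.
Qed.

(** Taking expectations in [onem_expRN_le] at time
    [t = 1 / phi (l q)], where [1 - exp (- t phi (l q))] is at least [1 / 2]. *)
Lemma laplace_exponent_scale l q : 1 <= l -> 0 < q -> 0 < phi (l * q) ->
  phi (l * q) <= 4 * l * phi q.
Proof.
move=> l1 q0 pp; have l0 : 0 < l by exact: lt_le_trans l1.
have key t : 0 <= t -> 1 - L (l * q) t <= 2 * l * (1 - L q t).
  move=> t0.
  have lq0 : 0 <= l * q by rewrite mulr_ge0 ?ltW.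
  have i1 := integrable_laplace_kernel hsigma lq0 t0.
  have i2 := integrable_laplace_kernel hsigma (ltW q0) t0.
  have ic (c : R) : P.-integrable setT (EFin \o (cst c : Omega -> R)).
    exact: finite_measure_integrable_cst.
  have one : 1 = \int[P]_w cst (1 : R) w.
    rewrite Rintegral_cst// mul1r.
    have : fine (P setT) = 1 by rewrite probability_setT.
    by move=> /esym H; exact: (etrans H).
  have ib q' : P.-integrable setT (EFin \o (fun w => laplace_kernel q' (sigma t w))) ->
    P.-integrable setT (EFin \o (fun w => 1 - laplace_kernel q' (sigma t w))).
    move=> iq; exact: (integrableB _ (ic 1) iq).
  have LB q' : P.-integrable setT (EFin \o (fun w => laplace_kernel q' (sigma t w))) ->
      1 - L q' t = \int[P]_w (1 - laplace_kernel q' (sigma t w)).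
    by move=> iq; rewrite [in LHS]one; exact/esym/(RintegralB measurableT (ic 1) iq).
  rewrite (LB _ i1) (LB _ i2) -RintegralZl//; last exact: ib.
  apply: le_Rintegral => //; first exact: ib.
    by apply: (@integrableZl _ _ _ P _ measurableT (2 * l) _ (ib _ i2)).
  move=> w _ /=; have := subordinator_ge0 hsigma w t0.
  rewrite /laplace_kernel; case: (sigma t w) => [a| |] //=; last first.
    by rewrite ?ltxx !mul0r !subr0 mulr1; move: l1; lra.
  rewrite ltry !mul1r lee_fin => a0; rewrite -mulrA; apply: onem_expRN_le => //.
  by rewrite mulr_ge0// ltW.
have lq0 : 0 < l * q by rewrite mulr_gt0.
have {}key t : 0 <= t ->
    1 - expR (- (t * phi (l * q))) <= 2 * l * (1 - expR (- (t * phi q))).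
  move=> t0; have := key _ t0.
  by rewrite (laplace_transform_exp lq0 t0) (laplace_transform_exp q0 t0).
move: (phi (l * q)) (phi q) pp key => a b a0 key.
have := key a^-1; rewrite invr_ge0 (ltW a0) mulVf ?gt_eqF// => /(_ isT) H.
have e2 : expR (- 1) <= 1 / 2 :> R.
  rewrite expRN div1r lef_pV2 ?posrE ?expR_gt0//.
  by apply: le_trans (expR_ge1Dx _).
have e3 : 1 - expR (- (a^-1 * b)) <= a^-1 * b.
  by rewrite lerBlDr addrC -lerBlDr; exact: expR_ge1Dx.
have : 1 / 2 <= 2 * l * (a^-1 * b).
  have : 2 * l * (1 - expR (- (a^-1 * b))) <= 2 * l * (a^-1 * b).
    by rewrite ler_pM2l// mulr_gt0.
  by move: H e2; lra.
rewrite mulrCA -ler_pdivrMl ?invr_gt0// invrK.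
lra.
Qed.

End laplace_exponent_facts.

(** * Frullani's integral *)

Section frullani.
Context {R : realType}.
Local Notation mu := (@lebesgue_measure R).
Local Notation D := (`]0%R, +oo[%classic : set R).

(** The integrand is the integral of [exp (- t u)] for [u] between [a] and [b];
    exchange the order of integration. *)
Lemma frullani_expR (a b : R) : 0 < a -> a <= b ->
  (\int[mu]_(t in D) (t^-1 * (expR (- (t * a)) - expR (- (t * b))))%:E
   = (ln (b / a))%:E)%E.
Proof.
move=> a0; rewrite le_eqVlt => /predU1P[<-|ab].
  rewrite divff ?gt_eqF// ln1; apply: integral0_eq => t _.
  by rewrite subrr mulr0.
rewrite -integral_invr//.
pose f (z : R * R) : \bar R :=
  ((0 < z.1)%R%:R * ((a <= z.2 <= b)%R%:R * expR (- (z.1 * z.2))))%:E.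
have mf : measurable_fun setT f.
  apply/measurable_EFinP/measurable_funM; last apply: measurable_funM.
  - apply: measurable_bool_indic; rewrite -[X in measurable X]setTI.
    under eq_set do rewrite -lte_fin.
    by apply: measurable_lte => //; apply/measurable_EFinP; exact: measurable_fst.
  - apply: measurable_bool_indic.
    rewrite (_ : [set z | _] = setT `&` snd @^-1` `[a, b]%classic).
      by apply: measurable_snd => //.
    by rewrite setTI; apply/seteqP; split => z /=; rewrite in_itv.
  - apply: measurableT_comp => //; apply: measurable_funN => //.
    by apply: measurable_funM; [exact: measurable_fst|exact: measurable_snd].
have f0 z : (0 <= f z)%E by rewrite lee_fin !mulr_ge0// expR_ge0.
have := @fubini_tonelli _ _ _ _ _ mu mu f mf f0.
have -> : (\int[mu]_t \int[mu]_u f (t, u)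
  = \int[mu]_(t in D) (t^-1 * (expR (- (t * a)) - expR (- (t * b))))%:E)%E.
  rewrite [RHS]integral_mkcond; apply: eq_integral => t _.
  rewrite /patch mem_setE in_itv/= andbT /f /=.
  case: ltP => t0; last by apply: integral0_eq => u _; rewrite mul0r.
  rewrite EFinM -(integral_expRMn t ab) -ge0_integralZl_EFin; last 4 first.
  - exact: measurable_itv.
  - by move=> u _; rewrite lee_fin mulr_ge0 ?expR_ge0// ltW.
  - by apply/measurable_EFinP/measurable_funM => //; exact: measurable_expRMn.
  - by rewrite invr_ge0 ltW.
  rewrite [RHS]integral_mkcond; apply: eq_integral => u _.
  rewrite /patch mem_setE in_itv/= mul1r.
  by case: (_ && _); rewrite ?mul0r// mul1r -EFinM mulKf// gt_eqF.
have -> : (\int[mu]_u \int[mu]_t f (t, u) = \int[mu]_(u in `[a, b]) (u^-1)%:E)%E.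
  rewrite [RHS]integral_mkcond; apply: eq_integral => u _.
  rewrite /patch mem_setE in_itv/= /f /=.
  case: ifPn => [/andP[au ub]|_]; last first.
    by apply: integral0_eq => t _; rewrite mul0r mulr0.
  have u0 : 0 < u by exact: lt_le_trans au.
  transitivity (u^-1%:E * \int[mu]_(t in D) (u * expR (- (u * t)))%:E)%E; last first.
    by rewrite integral_expRMny// mulr0 oppr0 expR0 mule1.
  rewrite -ge0_integralZl_EFin; last 4 first.
  - exact: measurable_itv.
  - by move=> t _; rewrite lee_fin mulr_ge0 ?expR_ge0// ltW.
  - by apply/measurable_EFinP/measurable_funM => //; exact: measurable_expRMn.
  - by rewrite invr_ge0 ltW.
  rewrite [RHS]integral_mkcond; apply: eq_integral => t _.
  rewrite /patch mem_setE in_itv/= andbT mul1r.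
  by case: (0 < t); rewrite ?mul0r// mul1r -EFinM mulKf ?gt_eqF// mulrC.
by [].
Qed.

End frullani.

(** * Joint measurability *)

Section harmonic_increments.
Context {R : realType} {d : measure_display} {Omega : measurableType d}
  {P : probability Omega R} {sigma : R -> Omega -> \bar R}.
Hypothesis hsigma : subordinator P sigma.
Local Notation mu := (@lebesgue_measure R).
Local Notation D := (`]0%R, +oo[%classic : set R).
Implicit Types (q s t y z l : R) (w : Omega).
Local Notation L := (@laplace_transform R d Omega P sigma).
Local Notation phi := (laplace_exponent P sigma).

(** Negative times are sent to [0], so that joint measurability can be stated
    on the whole product space. *)
Definition clamped_process (tw : R * Omega) := sigma (Num.max 0 tw.1) tw.2.

(** By monotonicity and right continuity, [sigma_t < y] if and only if
    [sigma_r < y] for some rational [r > t]: a countable union of measurable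
    rectangles. *)
Lemma measurable_clamped_process : measurable_fun setT clamped_process.
Proof.
apply: (measurability (@ErealGenInftyO.G R)).
  exact: ErealGenInftyO.measurableE.
move=> /= _ [_] [y] -> <-; rewrite setTI.
rewrite (_ : _ @^-1` _ = \bigcup_(r : rat)
    ([set t | Num.max 0 t < ratr r] `*` [set w | (sigma (Num.max 0 (ratr r))%R w < y%:E)%E])); last first.
  apply/seteqP; split => [[t w] /=|[t w] [r /= _] [/= tr rw]]; last first.
    rewrite in_itv/=; apply: le_lt_trans rw.
    apply: (sub_nondecreasing hsigma); first by rewrite le_max lexx.
    by rewrite le_max (ltW tr) orbT.
  rewrite in_itv /clamped_process/= => sy.
  have m0 : 0 <= Num.max 0 t by rewrite le_max lexx.
  have := sub_right_continuous hsigma (w:=w) m0.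
  have oy : open [set x : \bar R | (x < y%:E)%E] by exact: open_ereal_lt_ereal.
  move=> /(_ [set x | (x < y%:E)%E]) /(_ (open_nbhs_nbhs (conj oy sy)))[e /= e0 He].
  have /rat_in_itvoo[r] : Num.max 0 t < Num.max 0 t + e by rewrite ltrDl.
  rewrite in_itv/= => /andP[tr re]; exists r => //; split => //=.
  rewrite max_r; last by exact: le_trans (ltW tr).
  by apply: He => //=; rewrite distrC gtr0_norm ?subr_gt0// ltrBlDl.
apply: bigcupT_measurable_rat => r; apply: measurableX.
  under eq_set do rewrite gt_max.
  case: (0 < ratr r) => /=; last first.
    by rewrite (_ : [set _ | _] = set0)//; apply/seteqP; split.
  have -> : [set t : R | t < ratr r] = `]-oo, (ratr r)[%classic.
    by apply/seteqP; split => t /=; rewrite in_itv.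
  exact: measurable_itv.
rewrite -[X in measurable X]setTI; apply: measurable_lte => //.
by apply: (measurable_subordinator hsigma); rewrite le_max lexx.
Qed.

Definition increment_prob l t z := P [set w | (z%:E < sigma t w <= (l * z)%:E)%E].
Local Notation G := increment_prob.

Lemma measurable_increment_prob l :
  measurable_fun setT (fun tz : R * R => G l (Num.max 0 tz.1) tz.2).
Proof.
pose S := [set x : (R * R) * Omega |
  (x.1.2%:E < clamped_process (x.1.1, x.2) <= (l * x.1.2)%:E)%E].
have m1 : measurable_fun setT (fun x : (R * R) * Omega => x.1.1).
  exact: (measurableT_comp measurable_fst measurable_fst).
have m2 : measurable_fun setT (fun x : (R * R) * Omega => x.1.2).
  exact: (measurableT_comp measurable_snd measurable_fst).
have mc : measurable_fun setT (fun x : (R * R) * Omega => clamped_process (x.1.1, x.2)).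
  apply: (measurableT_comp measurable_clamped_process).
  apply/measurable_fun_pairP; split; first exact: m1.
  exact: measurable_snd.
have mS : measurable S.
  rewrite /S (_ : [set x | _] =
     (setT `&` [set x : (R * R) * Omega | (x.1.2%:E < clamped_process (x.1.1, x.2))%E])
     `&` (setT `&` [set x | (clamped_process (x.1.1, x.2) <= (l * x.1.2)%:E)%E])).
    apply: measurableI.
      by apply: measurable_lte => //; exact/measurable_EFinP.
    by apply: measurable_lee => //; apply/measurable_EFinP/measurable_funM.
  by rewrite !setTI; apply/seteqP; split => x /= => [/andP[]|[-> ->]].
pose f := fun x : (R * R) * Omega => (\1_S x : R)%:E.
have mf : measurable_fun setT f by apply/measurable_EFinP; exact: measurable_indic.
have f0 x : (0 <= f x)%E by rewrite lee_fin.
have := measurable_fun_fubini_tonelli_F (m2 := P) f mf f0.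
apply: eq_measurable_fun => -[t z] _; rewrite /fubini_F /f /G.
have mX : measurable [set w | (z%:E < sigma (Num.max 0 t)%R w <= (l * z)%:E)%E].
  have := measurable_xsection (t, z) mS.
  rewrite /xsection /S /= (_ : [set y | _] =
      [set w | (z%:E < sigma (Num.max 0 t)%R w <= (l * z)%:E)%E])//.
  by apply/seteqP; split => w /=; rewrite inE.
by rewrite -[in RHS](setIT [set w | _]) -integral_indic.
Qed.

End harmonic_increments.

(** * The Laplace transform of the harmonic increments *)

Section harmonic_laplace.
Context {R : realType} {d : measure_display} {Omega : measurableType d}
  {P : probability Omega R} {sigma : R -> Omega -> \bar R}.
Hypothesis hsigma : subordinator P sigma.
Local Notation mu := (@lebesgue_measure R).
Local Notation D := (`]0%R, +oo[%classic : set R).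
Implicit Types (q s t y z l p : R) (w : Omega).
Local Notation L := (@laplace_transform R d Omega P sigma).
Local Notation phi := (laplace_exponent P sigma).
Local Notation G := (@increment_prob R d Omega P sigma).

Lemma measurable_increment_event l t z : 0 <= t ->
  measurable [set w | (z%:E < sigma t w <= (l * z)%:E)%E].
Proof.
move=> t0; have mt := measurable_subordinator hsigma t0.
rewrite (_ : [set w | _] = (setT `&` [set w | (z%:E < sigma t w)%E])
    `&` (setT `&` [set w | (sigma t w <= (l * z)%:E)%E])).
  by apply: measurableI; [exact: measurable_lte|exact: measurable_lee].
by rewrite !setTI; apply/seteqP; split => w /= => [/andP[]|[-> ->]].
Qed.

Lemma increment_prob_ge0 l t z : (0 <= G l t z)%E.
Proof. exact: measure_ge0. Qed.

Lemma measurable_increment_prob_time l z : measurable_fun D (fun t => G l t z).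
Proof.
have : measurable_fun D ((fun tz : R * R => G l (Num.max 0 tz.1) tz.2) \o (fun t : R => (t, z))).
  apply: measurable_funTS.
  apply: (measurableT_comp (measurable_increment_prob hsigma l)).
  exact: measurable_pair2.
apply: eq_measurable_fun => t; rewrite inE/= in_itv/= andbT => t0.
by rewrite max_r// ltW.
Qed.

Lemma measurable_increment_prob_space l t : 0 <= t -> measurable_fun setT (G l t).
Proof.
move=> t0.
have : measurable_fun setT ((fun tz : R * R => G l (Num.max 0 tz.1) tz.2) \o (fun z : R => (t, z))).
  apply: (measurableT_comp (measurable_increment_prob hsigma l)).
  exact: measurable_pair1.
by apply: eq_measurable_fun => z _ /=; rewrite max_r.
Qed.

Lemma measurable_invr_pos : measurable_fun D (fun t : R => t^-1).
Proof.
have : measurable_fun D (@powR R ^~ (-1)).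
  by apply: measurable_funTS; exact: measurable_powR.
apply: eq_measurable_fun => t; rewrite inE/= in_itv/= andbT => t0.
by rewrite powR_inv1// ltW.
Qed.

(** Layering [sigma_t / l] at rate [p]. *)
Lemma laplace_transform_scale p l t : 0 < p -> 0 < l -> 0 <= t ->
  ((L (p / l) t)%:E = \int[mu]_(z in D) ((p * expR (- (p * z)))%:E
      * P [set w | (sigma t w <= (l * z)%:E)%E]))%E.
Proof.
move=> p0 l0 t0; have pl0 : 0 <= p / l by rewrite divr_ge0 ?ltW.
rewrite -(laplace_transformE hsigma pl0 t0).
pose X w := (l^-1%:E * sigma t w)%E.
have li0 : 0 < l^-1 by rewrite invr_gt0.
have mX : measurable_fun setT X.
  by apply: emeasurable_funM => //; exact: (measurable_subordinator hsigma).
have X0 w : (0 <= X w)%E.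
  by rewrite mule_ge0 ?lee_fin ?(ltW li0)//; exact: (subordinator_ge0 hsigma).
have := @layer_cake1 _ _ _ P p X p0 mX X0.
have -> : (\int[P]_w (laplace_kernel p (X w))%:E = \int[P]_w (laplace_kernel (p / l) (sigma t w))%:E)%E.
  apply: eq_integral => w _; congr EFin; have := subordinator_ge0 hsigma w t0.
  rewrite /X /laplace_kernel; case: (sigma t w) => [a| |] //= _.
    by rewrite !ltry mulrA.
  by rewrite gt0_muley ?lte_fin// ltxx !mul0r.
move=> ->; apply: eq_integral => z _; congr (_ * P _)%E.
apply/seteqP; split => w /=; rewrite /X.
  by rewrite muleC lee_pdivrMr// EFinM muleC.
by rewrite muleC lee_pdivrMr// EFinM muleC.
Qed.

Lemma laplace_transform_increment p l t : 0 < p -> 1 < l -> 0 <= t ->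
  (\int[mu]_(z in D) ((p * expR (- (p * z)))%:E * G l t z)
   = (L (p / l) t - L p t)%:E)%E.
Proof.
move=> p0 l1 t0; have l0 : 0 < l by exact: lt_trans l1.
have k0 z : 0 <= p * expR (- (p * z)) by rewrite mulr_ge0 ?expR_ge0// ltW.
have mk : measurable_fun D (fun z => (p * expR (- (p * z)))%:E).
  by apply/measurable_EFinP/measurable_funM => //; exact: measurable_expRMn.
have mG : measurable_fun D (G l t).
  by apply: measurable_funTS; exact: measurable_increment_prob_space.
have mF := measurable_cdf_subordinator hsigma t0.
have mS y : measurable [set w | (sigma t w <= y%:E)%E].
  rewrite -[X in measurable X]setTI; apply: measurable_lee => //.
  exact: (measurable_subordinator hsigma).
(* subtraction is avoided until both terms are known to be finite *)
have sum : ((L (p / l) t)%:E = (L p t)%:E + \int[mu]_(z in D) ((p * expR (- (p * z)))%:E * G l t z))%E.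
  rewrite laplace_transform_scale// (laplace_transform_layers hsigma)// -ge0_integralD//.
  - apply: eq_integral => z; rewrite inE/= in_itv/= andbT => z0.
    rewrite -ge0_muleDr//; congr (_ * _)%E.
    rewrite /G -measureU//; last 2 first.
    - exact: measurable_increment_event.
    - apply/seteqP; split => w //= [sz /andP[zs _]].
      by have := lt_le_trans zs sz; rewrite ltxx.
    congr (P _); apply/seteqP; split => w /=.
      by case: (leP (sigma t w) z%:E) => sz; [left|right].
    move=> [sz|/andP[]//]; apply: (le_trans sz).
    by rewrite lee_fin ler_peMl// ltW.
  - by move=> z _; rewrite mule_ge0 ?lee_fin.
  - by apply: emeasurable_funM => //; exact: measurable_funTS.
  - by move=> z _; rewrite mule_ge0 ?lee_fin.
  - exact: emeasurable_funM.
by rewrite EFinB sum addeAC subee// add0e.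
Qed.

(** The quantity in Sinai's condition: the mass that the harmonic measure
    [dt / t P (sigma_t \in dx)] gives to the interval from [z], excluded, to
    [l z], included. *)
Definition harmonic_increment l z :=
  (\int[mu]_(t in D) ((t^-1)%:E * G l t z))%E.
Local Notation H := harmonic_increment.

(** The integrand on the quadrant of pairs (time, space).  The power [-1]
    coincides there with the inverse and is measurable everywhere. *)
Let f p l (tz : R * R) : \bar R :=
  (((0 < tz.1)%R%:R * (0 < tz.2)%R%:R * (tz.1 `^ (-1) * (p * expR (- (p * tz.2)))))%:E
   * G l (Num.max 0 tz.1)%R tz.2)%E.

Let measurable_f p l : measurable_fun setT (f p l).
Proof.
apply: emeasurable_funM; last exact: (measurable_increment_prob hsigma).
have mpos : measurable_fun setT (fun x : R => (0 < x)%R%:R : R).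
  apply: measurable_bool_indic; rewrite -[X in measurable X]setTI.
  by under eq_set do rewrite -lte_fin; apply: measurable_lte.
apply/measurable_EFinP/measurable_funM; first apply: measurable_funM.
- exact: (measurableT_comp mpos measurable_fst).
- exact: (measurableT_comp mpos measurable_snd).
apply: measurable_funM.
  exact: (measurableT_comp (measurable_powR (-1)) measurable_fst).
apply: (@measurableT_comp _ _ _ _ _ _ (fun z : R => p * expR (- (p * z)))); last exact: measurable_snd.
by apply: measurable_funM => //; exact: measurable_expRMn.
Qed.

Let f_ge0 p l tz : 0 < p -> (0 <= f p l tz)%E.
Proof.
move=> p0; rewrite /f mule_ge0 ?increment_prob_ge0// lee_fin.
by rewrite !mulr_ge0// ?powR_ge0// ?expR_ge0// ltW.
Qed.

Let integral_f_time p l z : 0 < p ->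
  (\int[mu]_t f p l (t, z)
   = (\1_D z)%:E * ((p * expR (- (p * z)))%:E * H l z))%E.
Proof.
move=> p0; have [z0|z0] := ltP 0 z; last first.
  rewrite indicE (_ : z \in D = false) ?mul0e.
    by apply: integral0_eq => t _; rewrite /f /= (ltNge 0 z) z0 mulr0 mul0r mul0e.
  by apply/negbTE/negP; rewrite inE/= in_itv/= andbT ltNge z0.
rewrite indicE mem_set ?mul1e; last by rewrite /= in_itv/= z0.
rewrite -ge0_integralZl_EFin//; last 3 first.
- move=> t /=; rewrite in_itv/= andbT => t0.
  by rewrite mule_ge0 ?increment_prob_ge0// lee_fin invr_ge0 ltW.
- apply: emeasurable_funM; last exact: measurable_increment_prob_time.
  by apply/measurable_EFinP; exact: measurable_invr_pos.
- by rewrite mulr_ge0 ?expR_ge0// ltW.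
rewrite [RHS]integral_mkcond; apply: eq_integral => t _.
rewrite /patch mem_setE in_itv/= andbT /f /= z0.
case: (ltP 0 t) => t0; last by rewrite !mul0r mul0e.
rewrite powR_inv1 ?(ltW t0)// !mul1r muleA -EFinM.
by rewrite [t^-1 * _]mulrC.
Qed.

Let integral_f_space p l t : 0 < p -> 1 < l ->
  (\int[mu]_z f p l (t, z)
   = (\1_D t)%:E * (t^-1 * (L (p / l) t - L p t))%:E)%E.
Proof.
move=> p0 l1; have [t0|t0] := ltP 0 t; last first.
  rewrite indicE (_ : t \in D = false) ?mul0e.
    by apply: integral0_eq => z _; rewrite /f /= (ltNge 0 t) t0 !mul0r mul0e.
  by apply/negbTE/negP; rewrite inE/= in_itv/= andbT ltNge t0.
rewrite indicE mem_set ?mul1e; last by rewrite /= in_itv/= t0.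
rewrite EFinM -(laplace_transform_increment p0 l1 (ltW t0)).
rewrite -ge0_integralZl_EFin//; last 3 first.
- by move=> z _; rewrite mule_ge0 ?increment_prob_ge0// lee_fin mulr_ge0 ?expR_ge0// ltW.
- apply: emeasurable_funM.
    by apply/measurable_EFinP/measurable_funM => //; exact: measurable_expRMn.
  by apply: measurable_funTS; apply: measurable_increment_prob_space; exact: ltW.
- by rewrite invr_ge0 ltW.
rewrite [RHS]integral_mkcond; apply: eq_integral => z _.
rewrite /patch mem_setE in_itv/= andbT /f /= t0.
case: (0 < z); last by rewrite mulr0 mul0r mul0e.
by rewrite max_r ?(ltW t0)// powR_inv1 ?(ltW t0)// !mul1r muleA -EFinM.
Qed.

(** Exchanging time and space, the integral over space produces
    [exp (- t phi (p / l)) - exp (- t phi p)], and the one over time is then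
    Frullani's. *)
Lemma laplace_harmonic_increment p l : 0 < p -> 1 < l -> 0 < phi (p / l) ->
  (\int[mu]_(z in D) ((p * expR (- (p * z)))%:E * H l z)
   = (ln (phi p / phi (p / l)))%:E)%E.
Proof.
move=> p0 l1 pl; have l0 : 0 < l by exact: lt_trans l1.
have pl0 : 0 < p / l by rewrite divr_gt0.
have ppl : p / l <= p by rewrite ler_pdivrMr// ler_peMr// ltW.
rewrite -(frullani_expR pl (laplace_exponent_nondecr hsigma (ltW pl0) ppl)).
have := @fubini_tonelli _ _ _ _ _ mu mu (f p l) (measurable_f p l) (fun tz => f_ge0 l tz p0).
move=> FT; transitivity (\int[mu]_z \int[mu]_t f p l (t, z))%E.
  rewrite [LHS]integral_mkcond; apply: eq_integral => z _; rewrite (integral_f_time l z p0).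
  by rewrite /patch indicE; case: (z \in D); rewrite ?mul1e ?mul0e.
transitivity (\int[mu]_t \int[mu]_z f p l (t, z))%E; first exact: (esym FT).
rewrite [RHS]integral_mkcond; apply: eq_integral => t _; rewrite (integral_f_space t p0 l1).
rewrite /patch indicE; case: ifPn => [|_]; last by rewrite mul0e.
rewrite mul1e inE/= in_itv/= andbT => t0.
by rewrite (laplace_transform_exp hsigma pl0 (ltW t0)) (laplace_transform_exp hsigma p0 (ltW t0)).
Qed.

Lemma harmonic_increment_ge0 l z : (0 <= H l z)%E.
Proof.
apply: integral_ge0 => t /=; rewrite in_itv/= andbT => t0.
by rewrite mule_ge0 ?increment_prob_ge0// lee_fin invr_ge0 ltW.
Qed.

Lemma harmonic_increment_mono l m z y : 0 < y -> y <= z ->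
  l * z <= m * y -> (H l z <= H m y)%E.
Proof.
move=> y0 yz lm; apply: ge0_le_integral => //.
- move=> t /=; rewrite in_itv/= andbT => t0.
  by rewrite mule_ge0 ?increment_prob_ge0// lee_fin invr_ge0 ltW.
- apply: emeasurable_funM; last exact: measurable_increment_prob_time.
  by apply/measurable_EFinP; exact: measurable_invr_pos.
- apply: emeasurable_funM; last exact: measurable_increment_prob_time.
  by apply/measurable_EFinP; exact: measurable_invr_pos.
move=> t /=; rewrite in_itv/= andbT => t0.
apply: lee_pmul; [by rewrite lee_fin invr_ge0 ltW|exact: increment_prob_ge0|by []|].
have mE k x : measurable [set w | (x%:E < sigma t w <= (k * x)%:E)%E].
  by apply: measurable_increment_event; exact: ltW.
apply: le_measure; rewrite ?inE; [exact: mE|exact: mE|].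
move=> w /= /andP[zs sz]; apply/andP; split.
  by apply: le_lt_trans zs; rewrite lee_fin.
by apply: (le_trans sz); rewrite lee_fin.
Qed.

Lemma measurable_harmonic_increment l : measurable_fun D (H l).
Proof.
have := measurable_fun_fubini_tonelli_G (m1 := mu) (f 1 l) (measurable_f 1 l) (fun tz => f_ge0 l tz ltr01).
move=> /(@measurable_funTS _ _ _ _ D) mF.
have : measurable_fun D (fun z => (expR (1 * z))%:E * fubini_G mu (f 1 l) z)%E.
  apply: emeasurable_funM => //; apply/measurable_EFinP.
  apply: measurable_funTS; apply: measurableT_comp => //; exact: measurable_funM.
apply: eq_measurable_fun => z zD; rewrite /fubini_G integral_f_time// indicE zD mul1e.
by rewrite muleA -EFinM !mul1r -expRD subrr expR0 mul1e.
Qed.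

(** For [y] between [z / l] and [z], [H l z <= H (l ^ 2) y]; averaging over [y]
    at rate [1 / z] and using [laplace_harmonic_increment] bounds [H l z] by a
    multiple of the logarithm of a ratio of values of [phi], which are
    comparable. *)
Lemma harmonic_increment_le l z : 1 < l -> 0 < z ->
  (forall q, 0 < q -> 0 < phi q) ->
  (H l z <= (ln (4 * l ^+ 2) / (expR (- l^-1) - expR (- 1)))%:E)%E.
Proof.
move=> l1 z0 phi_gt0; have l0 : 0 < l by exact: lt_trans l1.
have l21 : 1 < l ^+ 2 by rewrite exprn_egt1.
have l20 : 0 < l ^+ 2 by exact: lt_trans l21.
pose p := z^-1; have p0 : 0 < p by rewrite invr_gt0.
have pl0 : 0 < p / l ^+ 2 by rewrite divr_gt0.
have c0 : 0 < expR (- l^-1) - expR (- 1).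
  by rewrite subr_gt0 ltr_expR ltrN2 invf_lt1.
have I := laplace_harmonic_increment p0 l21 (phi_gt0 _ pl0).
have B : (\int[mu]_(y in `[(z / l)%R, z]) ((p * expR (- (p * y)))%:E * H (l ^+ 2) y)
   <= (ln (phi p / phi (p / l ^+ 2)))%:E)%E.
  rewrite -I; apply: ge0_subset_integral => //.
  - apply: emeasurable_funM; last exact: measurable_harmonic_increment.
    by apply/measurable_EFinP/measurable_funM => //; exact: measurable_expRMn.
  - by move=> y _; rewrite mule_ge0 ?harmonic_increment_ge0// lee_fin mulr_ge0 ?expR_ge0// ltW.
  - move=> y /=; rewrite !in_itv/= andbT => /andP[zy _].
    by apply: lt_le_trans zy; rewrite divr_gt0.
have zl : z / l < z by rewrite ltr_pdivrMr// ltr_pMr.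
have A : ((expR (- l^-1) - expR (- 1))%:E * H l z
    <= \int[mu]_(y in `[(z / l)%R, z]) ((p * expR (- (p * y)))%:E * H (l ^+ 2) y))%E.
  have <- : (\int[mu]_(y in `[(z / l)%R, z]) (p * expR (- (p * y)))%:E = (expR (- l^-1) - expR (- 1))%:E)%E.
    by rewrite integral_expRMn// /p mulVf ?gt_eqF// mulKf ?gt_eqF.
  have mk : measurable_fun `[(z / l)%R, z] (fun y => (p * expR (- (p * y)))%:E).
    by apply/measurable_EFinP/measurable_funM => //; exact: measurable_expRMn.
  have k0 y : `[(z / l)%R, z]%classic y -> (0 <= (p * expR (- (p * y)))%:E)%E.
    by move=> _; rewrite lee_fin mulr_ge0 ?expR_ge0// ltW.
  have := ge0_integralZr mu (measurable_itv `[(z / l)%R, z]) mk k0 (harmonic_increment_ge0 l z).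
  move=> <-.
  apply: ge0_le_integral => //.
  - by move=> y _; rewrite mule_ge0 ?harmonic_increment_ge0// lee_fin mulr_ge0 ?expR_ge0// ltW.
  - by apply: emeasurable_funM; [exact: mk|exact: measurable_cst].
  - apply: emeasurable_funM.
      by apply/measurable_EFinP/measurable_funM => //; exact: measurable_expRMn.
    apply: measurable_funS (measurable_harmonic_increment (l ^+ 2)) => //.
    move=> y /=; rewrite !in_itv/= andbT => /andP[zy _].
    by apply: lt_le_trans zy; rewrite divr_gt0.
  move=> y /=; rewrite in_itv/= => /andP[zy yz].
  apply: lee_pmul => //; [by rewrite lee_fin mulr_ge0 ?expR_ge0// ltW|exact: harmonic_increment_ge0|].
  apply: harmonic_increment_mono => //; first by apply: lt_le_trans zy; rewrite divr_gt0.
  by rewrite expr2 -mulrA ler_pM2l// mulrC -ler_pdivrMr.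
have lnB : ln (phi p / phi (p / l ^+ 2)) <= ln (4 * l ^+ 2).
  have q1 := phi_gt0 _ p0; have q2 := phi_gt0 _ pl0.
  suff : phi p <= 4 * l ^+ 2 * phi (p / l ^+ 2).
    move: (phi p) (phi (p / l ^+ 2)) q1 q2 => a b a0 b0 ab.
    by rewrite ler_ln ?posrE ?divr_gt0 ?mulr_gt0// ler_pdivrMr.
  have := @laplace_exponent_scale _ _ _ _ _ hsigma (l ^+ 2) (p / l ^+ 2) (ltW l21) pl0.
  by rewrite (mulrC _ (p / _)) divfK ?gt_eqF// => /(_ q1).
rewrite -lee_fin in lnB; have := le_trans (le_trans A B) lnB.
have := harmonic_increment_ge0 l z; case: (H l z) => [h| |] // h0.
  by rewrite -EFinM !lee_fin mulrC -ler_pdivlMr.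
by rewrite gt0_muley// lte_fin.
Qed.

End harmonic_laplace.

(** * Sinai's condition and regular variation *)

Section sinai_regular_variation.
Context {R : realType} {d : measure_display} {Omega : measurableType d}
  {P : probability Omega R} {sigma : R -> Omega -> \bar R}.
Hypothesis hsigma : subordinator P sigma.
Local Notation mu := (@lebesgue_measure R).
Local Notation D := (`]0%R, +oo[%classic : set R).
Local Notation phi := (laplace_exponent P sigma).
Local Notation H := (@harmonic_increment R d Omega P sigma).
Implicit Types (l z p : R).
Hypothesis phi_gt0 : forall q, 0 < q -> 0 < phi q.

Let h l z := fine (H l z).

Let h_fin l z : 1 < l -> 0 < z -> H l z = (h l z)%:E.
Proof.
move=> l1 z0; rewrite fineK// ge0_fin_numE ?harmonic_increment_ge0//.
by apply: le_lt_trans (harmonic_increment_le hsigma l1 z0 phi_gt0) _; rewrite ltry.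
Qed.

Let h_ge0 l z : 1 < l -> 0 < z -> 0 <= h l z.
Proof. by move=> _ _; rewrite fine_ge0// harmonic_increment_ge0. Qed.

Let h_bounded l : 1 < l -> exists C, bounded_measurable (h l) C.
Proof.
move=> l1; exists (ln (4 * l ^+ 2) / (expR (- l^-1) - expR (- 1))); split.
  by apply: measurableT_comp => //; exact: (measurable_harmonic_increment hsigma).
move=> z z0; rewrite ger0_norm ?h_ge0// -lee_fin -h_fin//.
exact: (harmonic_increment_le hsigma).
Qed.

Let h_mono l m z y : 1 < l -> 1 < m -> 0 < y -> y <= z ->
  l * z <= m * y -> h l z <= h m y.
Proof.
move=> l1 m1 y0 yz lm; have z0 : 0 < z by exact: lt_le_trans yz.
by rewrite -lee_fin -!h_fin//; exact: (harmonic_increment_mono hsigma).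
Qed.

Lemma kernel_average_harmonic_increment l p : 1 < l -> 0 < p ->
  kernel_average (fun s => expR (- s)) (h l) p = ln (phi p / phi (p / l)).
Proof.
move=> l1 p0; have l0 : 0 < l by exact: lt_trans l1.
have pl0 : 0 < phi (p / l) by rewrite phi_gt0// divr_gt0.
have := laplace_harmonic_increment hsigma p0 l1 pl0.
move=> /(congr1 fine) /= <-; congr fine; apply: eq_integral => z.
by rewrite inE/= in_itv/= andbT => z0; rewrite h_fin.
Qed.

Lemma sinai_conditionP (F : set_system R) (beta : R) : Filter F ->
  (\forall z \near F, 0 < z) ->
  sinai_condition P sigma F beta <->
  forall l, 1 < l -> h l z @[z --> F] --> beta * ln l.
Proof.
move=> FF pos; split=> S l l1.
  by have /fine_cvgP[_] := S l l1.
have finF : \forall z \near F, H l z \is a fin_num.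
  by apply: filterS pos => z z0; rewrite h_fin.
by apply/fine_cvgP; split; [exact: finF|exact: S].
Qed.

(** Substituting [p = l x] turns [phi p / phi (p / l)] into
    [phi (l x) / phi x]; ratios with [l < 1] are inverses of ratios with
    [l > 1]. *)
Lemma cvg_laplace_exponent_ratio (G : set_system R) (beta : R) :
  Filter G -> (\forall p \near G, 0 < p) ->
  (forall c, 0 < c -> c * p @[p --> G] --> G) ->
  (forall l, 1 < l -> ln (phi p / phi (p / l)) @[p --> G] --> beta * ln l) <->
  regularly_varying phi G beta.
Proof.
move=> FG pos scale; split=> [S|[_ _ S] l l1]; last first.
  have l0 : 0 < l by exact: lt_trans l1.
  have ln0 : l != 0 by rewrite gt_eqF.
  have li0 : 0 < l^-1 by rewrite invr_gt0.
  have := cvg_comp _ _ (scale _ li0) (S l l0).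
  have c : {for l `^ beta, continuous (@ln R)} by apply: continuous_ln; exact: powR_gt0.
  move=> /(cvg_comp _ _) /(_ c).
  rewrite ln_powR; apply: cvg_trans; apply: near_eq_cvg.
  apply: nearW => p /=.
  rewrite (mulVKf ln0).
  have -> : p / l = l^-1 * p by exact: mulrC.
  reflexivity.
have up l : 1 < l -> phi (l * x) / phi x @[x --> G] --> l `^ beta.
  move=> l1; have l0 : 0 < l by exact: lt_trans l1.
  have := cvg_comp _ _ (scale _ l0) (S l l1).
  have c : {for beta * ln l, continuous (@expR R)} by exact: continuous_expR.
  move=> /(cvg_comp _ _) /(_ c).
  rewrite /powR gt_eqF//; apply: cvg_trans; apply: near_eq_cvg.
  apply: filterS pos => x x0 /=.
  have -> : l * x / l = x by rewrite mulrAC divff ?gt_eqF// mul1r.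
  rewrite lnK// posrE; apply: divr_gt0; apply: phi_gt0 => //.
  exact: mulr_gt0.
split; [exact: (measurable_laplace_exponent hsigma)|by move=> x; exact: (laplace_exponent_ge0 hsigma)|].
move=> l l0; have [l1|l1|->] := ltgtP l 1; [|exact: up|].
  have li1 : 1 < l^-1 by rewrite invf_gt1.
  have := cvg_comp _ _ (scale _ l0) (up _ li1).
  move=> /cvgV; rewrite gt_eqF ?powR_gt0 ?invr_gt0// => /(_ isT).
  have -> : (l^-1 `^ beta)^-1 = l `^ beta.
    by rewrite /powR !gt_eqF ?invr_gt0// lnV ?posrE// mulrN expRN invrK.
  apply: cvg_trans; apply: near_eq_cvg.
  have ln0 : l != 0 by rewrite gt_eqF.
  apply: nearW => x /=.
  rewrite (mulKf ln0) invf_div. reflexivity.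
have eq1 : {near G, (fun=> 1 : R) =1 (fun x => phi (1 * x) / phi x)}.
  by apply: filterS pos => x x0; rewrite mul1r divff// gt_eqF// phi_gt0.
rewrite powR1; apply: (cvg_trans (near_eq_cvg eq1)); exact: cvg_cst.
Qed.

Lemma sinai_regularly_varying (F G : set_system R) (beta : R) : dual_scales F G ->
  sinai_condition P sigma F beta <-> regularly_varying phi G beta.
Proof.
move=> FG; have [PF PG posF posG _ _ _] := FG.
rewrite sinai_conditionP// -cvg_laplace_exponent_ratio//; last exact: (dual_scale_mul FG).
have eqG l : 1 < l -> {near G, kernel_average (fun s => expR (- s)) (h l)
    =1 (fun p => ln (phi p / phi (p / l)))}.
  by move=> l1; apply: filterS posG => p p0; exact: kernel_average_harmonic_increment.
have eqG' l : 1 < l -> {near G, (fun p => ln (phi p / phi (p / l)))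
    =1 kernel_average (fun s => expR (- s)) (h l)}.
  by move=> l1; apply: filterS posG => p p0; rewrite kernel_average_harmonic_increment.
split=> [S l l1|S].
  have [C hC] := h_bounded l1.
  apply: (cvg_trans (near_eq_cvg (eqG l l1))).
  exact: (cvg_kernel_average FG hC (S l l1)).
apply: (tauberian_increments FG h_bounded h_ge0 h_mono) => l l1.
by apply: (cvg_trans (near_eq_cvg (eqG' l l1))); exact: S.
Qed.

End sinai_regular_variation.

Theorem theorem4 (R : realType) (d : measure_display)
    (Omega : measurableType d) (P : probability Omega R)
    (sigma : R -> Omega -> \bar R) (beta : R)
    (hsigma : subordinator P sigma)
    (* the degenerate process sigma = 0, for which phi = 0, is excluded *)
    (hnonzero : exists2 t : R, 0 <= t & ~ {ae P, forall w, sigma t w = 0%E})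
    (hbeta : 0 <= beta <= 1) :
  (sinai_condition P sigma 0^'+ beta <->
   regularly_varying (laplace_exponent P sigma) (pinfty_nbhs R) beta) /\
  (sinai_condition P sigma (pinfty_nbhs R) beta <->
   regularly_varying (laplace_exponent P sigma) 0^'+ beta).
Proof.
have phi_gt0 q (q0 : 0 < q) := laplace_exponent_gt0 hsigma hnonzero q0.
by split; apply: (sinai_regularly_varying hsigma phi_gt0);
  [exact: dual_scales_0y|exact: dual_scales_y0].
Qed.
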